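(* Let $\rho: I\rightarrow \mathrm{GL}(V)$ be an indecomposable continuous (finite-dimensional) $\overline{\mathbb{Q}}_\ell$-representation of $I=\mathrm{Gal}(k(\!(t)\!)^{sep}|k(\!(t)\!))$ and denote by $P\subset I$ the wild ramification subgroup. Suppose that $\rho(P^p[P,P])=1$ and that the Swan conductor satisfies $\mathrm{Sw}(V)<p$. Then $V$ is isomorphic to the representation corresponding to $$[r]_*(\mathscr{L}_\psi(\varphi)\otimes \mathscr{K})$$ for an integer $r$ prime to $p$, some $\varphi\in u^{-1}k[u^{-1}]$ (where $u^r=t$) and some tamely ramified $\overline{\mathbb{Q}}_\ell$-sheaf $\mathscr{K}$ on $\mathrm{Spec}\,k(\!(u)\!)$.
   Context: $k$ is the algebraic closure of a finite field of characteristic $p$, $\ell\neq p$ is a prime, and $\psi:\mathbb{F}_p\to\overline{\mathbb{Q}}_\ell^*$ is a fixed non-trivial additive character. $I$ is the absolute Galois group of $k(\!(t)\!)$; continuous $\overline{\mathbb{Q}}_\ell$-representations of $I$ are identified with lisse $\overline{\mathbb{Q}}_\ell$-sheaves on $\eta=\mathrm{Spec}\,k(\!(t)\!)$. $P$ is the absolute Galois group of the maximal tamely ramified extension of $k(\!(t)\!)$ (equivalently, the pro-$p$-Sylow subgroup of $I$); $P^p[P,P]$ is the subgroup generated by the $p$-th powers and the commutators of elements of $P$. A representation or sheaf is tamely ramified if $P$ acts trivially. Any $V$ has a unique slope (break) decomposition $V=\bigoplus_{y\in\mathbb{Q}_{\ge 0}}V(y)$ (with respect to the upper numbering filtration), and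 $\mathrm{Sw}(V)=\sum_y y\dim V(y)$. $\mathscr{L}_\psi$ is the Artin-Schreier sheaf on $\mathbb{A}^1$ attached to $\psi$. For $\varphi\in u^{-1}k[u^{-1}]$, $\mathscr{L}_\psi(\varphi)$ is the pull-back of $\mathscr{L}_\psi$ to $\mathrm{Spec}\,k(\!(u)\!)$ along the map to $\mathbb{A}^1$ given by $\varphi$. For $r\geq 1$ prime to $p$, $[r]:\mathrm{Spec}\,k(\!(u)\!)\to\mathrm{Spec}\,k(\!(t)\!)$ is the covering given by $t=u^r$; the push-forward $[r]_*$ corresponds to induction to $I$ from its unique open (normal) subgroup $I(r)=\mathrm{Gal}(k(\!(t)\!)^{sep}|k(\!(u)\!))$ of index $r$. *)

(* Defs.v *)
From HB Require Import structures.
From mathcomp Require Import all_boot all_order all_algebra all_fingroup.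
From mathcomp Require Import all_field.
From mathcomp Require Import fraction mxpoly.
From mathcomp Require Import boolp classical_sets.

Set Implicit Arguments.
Unset Strict Implicit.
Unset Printing Implicit Defensive.

Import Order.TTheory GRing.Theory Num.Theory.
Local Open Scope ring_scope.

Record fps (k : fieldType) := Fps { fpscoef : nat -> k }.

HB.instance Definition _ (k : fieldType) := gen_eqMixin (fps k).
HB.instance Definition _ (k : fieldType) := gen_choiceMixin (fps k).

Section PowerSeries.
Variable k : fieldType.
Implicit Types f g h : fps k.

Lemma fpsP f g : (forall n, fpscoef f n = fpscoef g n) <-> f = g.
Proof.
split=> [|-> //]; case: f g => f [g] /= fg.
by congr Fps; apply/funext.
Qed.

Definition fps_zero := Fps (fun _ => 0 : k).
Definition fps_opp f := Fps (fun n => - fpscoef f n).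
Definition fps_add f g := Fps (fun n => fpscoef f n + fpscoef g n).

Fact fps_addA : associative fps_add.
Proof. by move=> f g h; apply/fpsP => n /=; rewrite addrA. Qed.
Fact fps_addC : commutative fps_add.
Proof. by move=> f g; apply/fpsP => n /=; rewrite addrC. Qed.
Fact fps_add0 : left_id fps_zero fps_add.
Proof. by move=> f; apply/fpsP => n /=; rewrite add0r. Qed.
Fact fps_addN : left_inverse fps_zero fps_opp fps_add.
Proof. by move=> f; apply/fpsP => n /=; rewrite addNr. Qed.

HB.instance Definition _ :=
  GRing.isZmodule.Build (fps k) fps_addA fps_addC fps_add0 fps_addN.

Definition fpsC (c : k) : fps k := Fps (fun n => if n == 0%N then c else 0).
Definition fpsX : fps k := Fps (fun n => (n == 1%N)%:R).
Definition fps_mul f g :=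
  Fps (fun n => \sum_(i < n.+1) fpscoef f i * fpscoef g (n - i)%N).

Definition fps_trunc n f : {poly k} := \poly_(i < n) fpscoef f i.

Lemma coef_fps_trunc n f i :
  (fps_trunc n f)`_i = if (i < n)%N then fpscoef f i else 0.
Proof. by rewrite coef_poly. Qed.

Lemma fps_mulE f g n m : (n < m)%N ->
  fpscoef (fps_mul f g) n = (fps_trunc m f * fps_trunc m g)`_n.
Proof.
move=> nm; rewrite coefM; apply: eq_bigr => i _.
have im : (i < m)%N by apply: leq_ltn_trans nm; rewrite -ltnS.
by rewrite !coef_fps_trunc im (leq_ltn_trans (leq_subr _ _) nm).
Qed.

Fact fps_mulC : commutative fps_mul.
Proof.
move=> f g; apply/fpsP => n.
by rewrite (@fps_mulE f g _ n.+1) // (@fps_mulE g f _ n.+1) // mulrC.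
Qed.

Fact fps_mulA : associative fps_mul.
Proof.
move=> f g h; apply/fpsP => n.
transitivity
  ((fps_trunc n.+1 f * (fps_trunc n.+1 g * fps_trunc n.+1 h))`_n).
  rewrite coefM; apply: eq_bigr => i _.
  by rewrite coef_fps_trunc ltn_ord (@fps_mulE _ _ _ n.+1) // ltnS leq_subr.
rewrite mulrA coefM; apply: eq_bigr => i _.
by rewrite coef_fps_trunc ltnS leq_subr (@fps_mulE _ _ _ n.+1).
Qed.

Fact fps_mul1 : left_id (fpsC 1) fps_mul.
Proof.
move=> f; apply/fpsP => n /=; rewrite big_ord_recl /= subn0 mul1r.
by rewrite big1 ?addr0 // => i _; rewrite mul0r.
Qed.

Fact fps_mulDl : left_distributive fps_mul fps_add.
Proof.
move=> f g h; apply/fpsP => n /=; rewrite -big_split /=.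
by apply: eq_bigr => i _; rewrite mulrDl.
Qed.

Fact fps_1neq0 : fpsC 1 != 0.
Proof. by apply/eqP => /fpsP/(_ 0%N)/eqP; rewrite /= oner_eq0. Qed.

HB.instance Definition _ := GRing.Zmodule_isComNzRing.Build (fps k)
  fps_mulA fps_mulC fps_mul1 fps_mulDl fps_1neq0.

Definition fps_unit : {pred fps k} := fun f => `[< exists g, g * f = 1 >].
Definition fps_inv f : fps k :=
  if pselect (exists g, g * f = 1) is left ex then projT1 (cid ex) else f.

Fact fps_mulVr : {in fps_unit, left_inverse 1 fps_inv *%R}.
Proof.
move=> f /asboolP fU; rewrite /fps_inv; case: pselect => // e.
by case: (cid e).
Qed.
Fact fps_unitP f g : g * f = 1 -> fps_unit f.
Proof. by move=> gf; apply/asboolP; exists g. Qed.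
Fact fps_invr_out : {in [predC fps_unit], fps_inv =1 id}.
Proof.
move=> f /asboolPn fU; rewrite /fps_inv; case: pselect => // e.
Qed.

HB.instance Definition _ := GRing.ComNzRing_hasMulInverse.Build (fps k)
  fps_mulVr fps_unitP fps_invr_out.

Lemma fps_neq0 f : f != 0 ->
  exists n, fpscoef f n != 0 /\ forall i, (i < n)%N -> fpscoef f i = 0.
Proof.
move=> f0; have ex : exists n, fpscoef f n != 0.
  apply: contrapT => nex; move/eqP: f0; apply; apply/fpsP => n.
  by apply: contrapT => /eqP fn; apply: nex; exists n.
exists (ex_minn ex); case: ex_minnP => n fn nmin; split=> // i lt_in.
by apply: contraTeq lt_in => /nmin; rewrite -leqNgt.
Qed.

Fact fps_integral : GRing.integral_domain_axiom (fps k).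
Proof.
move=> f g fg0; apply: contrapT => /negP.
rewrite negb_or => /andP[/fps_neq0[m [fm fmin]] /fps_neq0[n [gn gmin]]].
move/fpsP/(_ (m + n)%N): fg0 => /=.
have mP : (m < (m + n).+1)%N by rewrite ltnS leq_addr.
rewrite (bigD1 (Ordinal mP)) //= addKn big1 ?addr0.
  by move/eqP; rewrite mulf_eq0 (negPf fm) (negPf gn).
move=> i; rewrite -val_eqE /= neq_ltn => /orP[/fmin->|mi].
  by rewrite mul0r.
by rewrite [X in _ * X]gmin ?mulr0 // ltn_subLR ?ltn_add2r // -ltnS.
Qed.

HB.instance Definition _ :=
  GRing.ComUnitRing_isIntegral.Build (fps k) fps_integral.

End PowerSeries.

Definition laurent (k : fieldType) : fieldType := {fraction fps k}.

Definition fps_laurent (k : fieldType) (f : fps k) : laurent k := tofrac f.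
Definition laurentC (k : fieldType) (c : k) : laurent k := fps_laurent (fpsC c).
Definition laurentX (k : fieldType) : laurent k := fps_laurent (fpsX k).

Definition separable_closure (K L : fieldType) (iota : {rmorphism K -> L}) :=
  (forall x : L, exists q : {poly K},
     separable_poly q /\ root (map_poly iota q) x) /\
  (forall q : {poly L}, separable_poly q -> (1 < size q)%N ->
     exists x, root q x).

Record absgal (K L : fieldType) (iota : K -> L) := AbsGal {
  absgal_fun :> L -> L;
  absgal_zmod : zmod_morphism absgal_fun;
  absgal_monoid : GRing.monoid_morphism absgal_fun;
  absgal_bij : bijective absgal_fun;
  absgal_fix : forall c, absgal_fun (iota c) = iota c
}.

HB.instance Definition _ K L iota := gen_eqMixin (@absgal K L iota).
HB.instance Definition _ K L iota := gen_choiceMixin (@absgal K L iota).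

Section AbsGal.
Variables (K L : fieldType) (iota : K -> L).
Implicit Types g h : absgal iota.

Lemma absgalP g h : g =1 h -> g = h.
Proof.
case: g h => [g ga gm gb gf] [h ha hm hb hf] /= /funext gh.
by case: _ / gh in ha hm hb hf *; congr AbsGal; apply: Prop_irrelevance.
Qed.

Definition absgal_one : absgal iota.
Proof.
by apply: (@AbsGal K L iota id) => //; exists id.
Defined.

Definition absgal_mul g h : absgal iota.
Proof.
apply: (@AbsGal K L iota (g \o h)).
- by move=> x y /=; rewrite !absgal_zmod.
- split=> [|x y] /=; first by rewrite !(absgal_monoid _).1.
  by rewrite !(absgal_monoid _).2.
- by apply: bij_comp; apply: absgal_bij.
- by move=> c /=; rewrite !absgal_fix.
Defined.

Lemma absgal_inverse g : {h : absgal iota | cancel g h & cancel h g}.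
Proof.
have [f gK fK] : {f | cancel g f & cancel f g}.
  by apply: cid2; case: (absgal_bij g) => f; exists f.
suff [h hf] : {h : absgal iota | h =1 f}.
  by exists h => x; rewrite hf.
apply: (exist _ (@AbsGal K L iota f _ _ _ _)) => //.
- by move=> x y; apply: (can_inj gK); rewrite absgal_zmod !fK.
- split=> [|x y]; apply: (can_inj gK).
    by rewrite fK (absgal_monoid g).1.
  by rewrite fK (absgal_monoid g).2 !fK.
- by exists g.
- by move=> c; apply: (can_inj gK); rewrite fK absgal_fix.
Qed.

Definition absgal_inv g : absgal iota := s2val (absgal_inverse g).

Fact absgal_mulA : associative absgal_mul.
Proof. by move=> f g h; apply: absgalP. Qed.
Fact absgal_mul1 : left_id absgal_one absgal_mul.
Proof. by move=> f; apply: absgalP. Qed.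
Fact absgal_mulr1 : right_id absgal_one absgal_mul.
Proof. by move=> f; apply: absgalP. Qed.
Fact absgal_mulV : left_inverse absgal_one absgal_inv absgal_mul.
Proof. by move=> f; apply: absgalP => x; apply: (s2valP (absgal_inverse f)). Qed.
Fact absgal_mulrV : right_inverse absgal_one absgal_inv absgal_mul.
Proof. by move=> f; apply: absgalP => x; apply: (s2valP' (absgal_inverse f)). Qed.

HB.instance Definition _ := isGroup.Build (absgal iota)
  absgal_mulA absgal_mul1 absgal_mulr1 absgal_mulV absgal_mulrV.

End AbsGal.

Definition subgroup_generated (G : groupType) (A : set G) : set G :=
  fun g => forall H : set G, H 1%g ->
    (forall x y, H x -> H y -> H (x * y^-1)%g) -> (A `<=` H)%classic -> H g.

Section FiniteExtensions.
Variables (k : fieldType) (L : fieldExtType (laurent k)).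

Definition intring (x : L) : Prop :=
  integralOver (fun f : fps k => (fps_laurent f)%:A : L) x.

Definition max_ideal (x : L) : Prop :=
  intring x /\ ~ (exists2 y, intring y & x * y = 1).

Definition uniformizer (pi : L) : Prop :=
  max_ideal pi /\ forall x, max_ideal x -> exists2 y, intring y & x = pi * y.

Definition max_ideal_exp (n : nat) (x : L) : Prop :=
  exists pi y, [/\ uniformizer pi, intring y & x = pi ^+ n * y].

Definition ramification_index (e : nat) : Prop :=
  exists pi y z, [/\ uniformizer pi, intring y, intring z, y * z = 1
    & (laurentX k)%:A = pi ^+ e * y].

(* There is no residue field condition: this is only meant for k
   algebraically closed, when every residue field extension is trivial. *)
Definition tamely_ramified (p : nat) : Prop :=
  exists2 e, ramification_index e & ~~ (p %| e)%N.

End FiniteExtensions.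

Section RamificationGroups.
Variables (k : fieldType) (L : splittingFieldType (laurent k)).

Definition lower_ramification (i : nat) : {set gal_of {:L}} :=
  [set s : gal_of {:L} |
     `[< forall x : L, intring x -> max_ideal_exp i.+1 (s x - x) >]].

(* Herbrand's function, the integral from 0 to u of 1/[G_0 : G_x] for u >= 0,
   where G_x is G_i for i the ceiling of x. *)
Definition herbrand (u : rat) : rat :=
  let m := Num.truncn u in
  (\sum_(1 <= i < m.+1) #|lower_ramification i|%:R
     + (u - m%:R) * #|lower_ramification m.+1|%:R)
  / #|lower_ramification 0|%:R.

Definition upper_ramification (y : rat) (s : gal_of {:L}) : Prop :=
  exists u : rat, [/\ 0 <= u, herbrand u = y
    & s \in lower_ramification `|Num.ceil u|%N].

End RamificationGroups.

Section Filtration.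
Variables (k Ksep : fieldType) (iota : laurent k -> Ksep).

Definition embedding (L : fieldExtType (laurent k)) (j : {rmorphism L -> Ksep}) :=
  forall c, j c%:A = iota c.

Definition wild_inertia (p : nat) : set (absgal iota) := fun g =>
  forall (L : fieldExtType (laurent k)) (j : {rmorphism L -> Ksep}),
    embedding j -> tamely_ramified L p -> forall x, g (j x) = j x.

Definition upper_numbering (y : rat) : set (absgal iota) := fun g =>
  forall (L : splittingFieldType (laurent k)) (j : {rmorphism L -> Ksep}),
    embedding j -> galois 1 {:L} ->
    exists2 s : gal_of {:L}, upper_ramification y s
      & forall x, g (j x) = j (s x).

Definition wild_pth_powers_commutators (p : nat) : set (absgal iota) :=
  subgroup_generated (fun g =>
    (exists2 x, wild_inertia p x & g = (x ^+ p)%g) \/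
    (exists x y, [/\ wild_inertia p x, wild_inertia p y & g = [~ x, y]%g])).

(* When u ^+ r is the image of t this is I(r), as k((u)) is the extension of
   k((t)) generated by u. For r prime to p it contains P, which is also the
   wild inertia group of k((u)). *)
Definition galois_over_root (u : Ksep) : set (absgal iota) :=
  fun g => g u = u.

End Filtration.

(* The value at 0, which should be infinite, is irrelevant below. *)
Definition padic_val (l : nat) (q : rat) : rat :=
  (logn l `|numq q|%N)%:R - (logn l `|denq q|%N)%:R.

Definition field_valuation (F : fieldType) (v : F -> rat) : Prop :=
  (forall x y, x != 0 -> y != 0 -> v (x * y) = v x + v y) /\
  (forall x y, x != 0 -> y != 0 -> x + y != 0 ->
     Num.min (v x) (v y) <= v (x + y)).

Definition val_gt (F : fieldType) (v : F -> rat) (N : rat) (x : F) : Prop :=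
  x = 0 \/ N < v x.

Record is_padic_field (l : nat) (F : fieldType) (v : F -> rat) : Prop := {
  padic_valuation : field_valuation v;
  padic_char0 : [pchar F] =i pred0;
  padic_extends : forall q : rat, q != 0 -> v (ratr q) = padic_val l q;
  padic_dense : forall (x : F) N, exists q : rat, val_gt v N (x - ratr q);
  padic_complete : forall s : nat -> F,
    (forall N, exists M, forall m n, (M <= m)%N -> (M <= n)%N ->
       val_gt v N (s m - s n)) ->
    exists x, forall N, exists M, forall n, (M <= n)%N -> val_gt v N (s n - x)
}.

Record is_padic_closure (F E : fieldType) (vF : F -> rat)
    (j : {rmorphism F -> E}) (vE : E -> rat) : Prop := {
  padic_algebraic : forall x : E, algebraicOver j x;
  padic_closure_valuation : field_valuation vE;
  padic_closure_extends : forall x : F, x != 0 -> vE (j x) = vF x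
}.

Section Representations.
Variables (K L : fieldType) (iota : K -> L).
Variables (E : fieldType) (v : E -> rat).
Local Notation G := (absgal iota).

(* A representation of the subgroup H is a map on the whole group G whose
   values outside H are irrelevant. Continuity is that of the matrix
   coefficients, for the Krull topology on H. *)
Record continuous_rep (H : set G) (V : vectType E) (rho : G -> 'End(V)) : Prop := {
  rep1 : rho 1%g = \1%VF;
  repM : forall g h, H g -> H h -> rho (g * h)%g = (rho g \o rho h)%VF;
  rep_continuous : forall (x : V) (i : 'I_(\dim {:V})) (g : G) (N : rat), H g ->
    exists s : seq L, forall h, H h -> (forall y, y \in s -> h y = g y) ->
      val_gt v N (coord (vbasis {:V}) i (rho h x) - coord (vbasis {:V}) i (rho g x))
}.

Definition stable (V : vectType E) (rho : G -> 'End(V)) (U : {vspace V}) : Prop :=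
  forall g x, x \in U -> rho g x \in U.

Definition indecomposable (V : vectType E) (rho : G -> 'End(V)) : Prop :=
  {:V}%VS <> 0%VS /\
  forall U W : {vspace V}, stable rho U -> stable rho W ->
    (U + W)%VS = {:V}%VS -> (U :&: W)%VS = 0%VS -> U = 0%VS \/ W = 0%VS.

(* Phi identifies rho with the representation induced from sigma, realized by
   right translation on the functions f : G -> W with
   f (h * g) = sigma h (f g) for h in H. *)
Definition iso_induced (H : set G) (W : vectType E) (sigma : G -> 'End(W))
    (V : vectType E) (rho : G -> 'End(V)) : Prop :=
  exists Phi : V -> (G -> W),
    [/\ forall a x y g, Phi (a *: x + y) g = a *: Phi x g + Phi y g,
        injective Phi,
        forall f, (exists x, Phi x = f) <->
          (forall h g, H h -> f (h * g)%g = sigma h (f g))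
      & forall g x g', Phi (rho g x) g' = Phi x (g' * g)%g].

End Representations.

Section Slopes.
Variables (p : nat) (k Ksep : fieldType) (iota : laurent k -> Ksep).
Variables (E : fieldType) (V : vectType E) (rho : absgal iota -> 'End(V)).

Record slope_decomposition (Vs : rat -> {vspace V}) (ys : seq rat) : Prop := {
  slope_uniq : uniq ys;
  slope_ge0 : forall y, y \in ys -> 0 <= y;
  slope_supp : forall y, y \notin ys -> Vs y = 0%VS;
  slope_stable : forall y, stable rho (Vs y);
  slope_sum : (\sum_(y <- ys) Vs y)%VS = {:V}%VS;
  slope_direct : directv (\sum_(y <- ys) Vs y)%VS;
  slope_tame : forall x, x \in Vs 0 <->
    (forall g, wild_inertia p g -> rho g x = x);
  slope_no_inv : forall y x, 0 < y -> x \in Vs y ->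
    (forall g, upper_numbering y g -> rho g x = x) -> x = 0;
  slope_inv : forall y z x g, 0 <= y -> y < z -> x \in Vs y ->
    upper_numbering z g -> rho g x = x
}.

Definition swan (s : rat) : Prop :=
  exists Vs ys, slope_decomposition Vs ys /\
    s = \sum_(y <- ys) y * (\dim (Vs y))%:R.

End Slopes.

Record nontrivial_additive_char (p : nat) (E : fieldType) (psi : 'F_p -> E) : Prop := {
  addchar0 : psi 0 = 1;
  addcharD : forall a b, psi (a + b) = psi a * psi b;
  addchar_nontrivial : exists a, psi a <> 1
}.

(* phi is the polynomial in u^-1 whose value is taken. *)
Definition eval_at_inv (k Ksep : fieldType) (iota : laurent k -> Ksep)
    (phi : {poly k}) (u : Ksep) : Ksep :=
  (map_poly (fun c => iota (laurentC c)) phi).[u^-1].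

(* The character of L_psi(c): if y ^ p - y = c then g is sent to psi (g y - y),
   which does not depend on the choice of y when g fixes c. The opposite sign
   convention amounts to replacing c by - c. *)
Definition artin_schreier_char (p : nat) (K L : fieldType) (iota : K -> L)
    (E : fieldType) (psi : 'F_p -> E) (c : L) (g : absgal iota) : E :=
  if [pick a : 'F_p |
       `[< exists y : L, y ^+ p - y = c /\ g y - y = (a : nat)%:R >]]
  is Some a then psi a else 0.

(* Main.v *)
Require Import Defs.
From HB Require Import structures.
From mathcomp Require Import all_boot all_order all_algebra all_fingroup.
From mathcomp Require Import all_field.
From mathcomp Require Import fraction mxpoly generic_quotient.
From mathcomp Require Import boolp classical_sets.
From mathcomp Require Import ring.
Set Implicit Arguments.
Unset Strict Implicit.
Unset Printing Implicit Defensive.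
Import Order.TTheory GRing.Theory Num.Theory.
Local Open Scope ring_scope.

(** The wild inertia group P acts on V through commuting operators of order p, so V
    has a basis of simultaneous eigenvectors ([eigenbasis]), each with a character
    of P. The inertia group permutes the isotypic components, transitively as V is
    indecomposable ([single_orbit]). By Clifford theory V is then induced from the
    stabilizer H of one of the characters, acting on its isotypic component
    ([induced_from_stabilizer]). It remains to show that H is the group fixing some
    root u of t of degree prime to p, and that the character extends to H as the
    character of an Artin-Schreier equation whose constant is a polynomial in
    1/u without constant term. Dividing the action of H on the isotypic component
    by this extension leaves a representation that is trivial on P.

    Both facts come from a single element y of the separable closure. Through psi
    the character becomes a homomorphism a from P to the prime field, which is
    continuous since a p-th root of unity close to 1 is 1. By additive Hilbert 90
    ([hilbert90]) there is y with g y - y = a g for all g in P, and c = y ^ p - y is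
    fixed by P, that is, belongs to k((w)) for some root w of t of degree prime to p
    ([wild_invariants_tame]). Subtracting from y an element of k((w)), one may
    assume that c is a polynomial in 1/w all of whose exponents are prime to p
    ([as_reduction]), and there is only one such c in its class modulo the elements
    z ^ p - z, even with z in a larger tame extension ([as_reduction_unique],
    [as_reduced_rigid]). An element h of the inertia group preserves a if and only
    if h y - y is fixed by P, hence, by this uniqueness, if and only if it fixes c. As
    h multiplies w by a root of unity, this means that it fixes u = w ^ d, where d is
    the gcd of the degree of w and of the exponents of c ([character_field]). On H
    the differences h y - y lie in the prime field, so psi (h y - y) is the required
    extension.

    Two general facts support this. The first is that the wild inertia group is the
    group fixing all roots of t of degree prime to p. That it fixes them means that
    k((w)) is tamely ramified ([radical_tame]). Conversely, a tame extension is
    generated by a uniformizer pi that satisfies an Eisenstein equation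
    ([eisenstein]), from which Hensel's lemma shows that pi is a power series in a
    root of t ([tame_roots_fixed]). The second is that the separable closure has
    enough automorphisms, which is proved with Zorn's lemma
    ([automorphism_extension], [fixed_by_stabilizer]). *)

(** * Power series and Hensel's lemma *)

Section PowerSeriesTheory.
Variable k : fieldType.
Implicit Types (f g : fps k) (c : k) (m n : nat).

Fact fpsC_zmod_morphism : zmod_morphism (@fpsC k).
Proof. by move=> a b; apply/fpsP => -[|n] /=; rewrite ?subr0. Qed.
HB.instance Definition _ :=
  GRing.isZmodMorphism.Build k (fps k) (@fpsC k) fpsC_zmod_morphism.

Lemma coef_fps0 n : fpscoef (0 : fps k) n = 0. Proof. by []. Qed.

Lemma coef_fps1 n : fpscoef (1 : fps k) n = (n == 0)%:R.
Proof. by case: n. Qed.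

Lemma coef_fpsD f g n : fpscoef (f + g) n = fpscoef f n + fpscoef g n.
Proof. by []. Qed.

Lemma coef_fpsB f g n : fpscoef (f - g) n = fpscoef f n - fpscoef g n.
Proof. by []. Qed.

Lemma coef_fpsM f g n :
  fpscoef (f * g) n = \sum_(i < n.+1) fpscoef f i * fpscoef g (n - i)%N.
Proof. by []. Qed.

Lemma coef_fps_sum I (r : seq I) (P : pred I) (F : I -> fps k) n :
  fpscoef (\sum_(i <- r | P i) F i) n = \sum_(i <- r | P i) fpscoef (F i) n.
Proof.
by elim/big_rec2: _ => [|i a b _ <-]; rewrite ?coef_fps0.
Qed.

Lemma coef_fpsCM c f n : fpscoef (fpsC c * f) n = c * fpscoef f n.
Proof.
rewrite coef_fpsM big_ord_recl /= subn0 big1 ?addr0 // => i _.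
by rewrite mul0r.
Qed.

Lemma coef_fpsXM f n :
  fpscoef (fpsX k * f) n = if n is n'.+1 then fpscoef f n' else 0.
Proof.
rewrite coef_fpsM; case: n => [|n].
  by rewrite big_ord1 /= mul0r.
rewrite !big_ord_recl /= mul0r add0r mul1r big1 ?addr0 ?subSS ?subn0 // => i _.
by rewrite mul0r.
Qed.

Lemma coef_fpsXnM f m n :
  fpscoef (fpsX k ^+ m * f) n = if (n < m)%N then 0 else fpscoef f (n - m)%N.
Proof.
elim: m n => [|m IH] n; first by rewrite expr0 mul1r subn0.
by rewrite exprS -mulrA coef_fpsXM; case: n => [|n] //; rewrite IH ltnS subSS.
Qed.

Lemma coef_fpsXn m n : fpscoef (fpsX k ^+ m) n = (n == m)%:R.
Proof.
rewrite -[_ ^+ m]mulr1 coef_fpsXnM coef_fps1 subn_eq0.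
by case: ltngtP.
Qed.

Fact fpsC_monoid_morphism : GRing.monoid_morphism (@fpsC k).
Proof.
split=> // a b; apply/fpsP => -[|n]; rewrite coef_fpsCM //=.
by rewrite mulr0.
Qed.
HB.instance Definition _ :=
  GRing.isMonoidMorphism.Build k (fps k) (@fpsC k) fpsC_monoid_morphism.

Definition fps_const f : k := fpscoef f 0.

Fact fps_const_zmod_morphism : zmod_morphism fps_const.
Proof. by []. Qed.
Fact fps_const_monoid_morphism : GRing.monoid_morphism fps_const.
Proof.
by split=> // f g; rewrite /fps_const coef_fpsM big_ord1 subn0.
Qed.
HB.instance Definition _ :=
  GRing.isZmodMorphism.Build (fps k) k fps_const fps_const_zmod_morphism.
HB.instance Definition _ :=
  GRing.isMonoidMorphism.Build (fps k) k fps_const fps_const_monoid_morphism.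

Definition fps_shift m f : fps k := Fps (fun i => fpscoef f (m + i)).

Lemma fps_trunc_shift m f :
  f = \sum_(i < m) fpsC (fpscoef f i) * fpsX k ^+ i + fpsX k ^+ m * fps_shift m f.
Proof.
apply/fpsP => n; rewrite coef_fpsD coef_fps_sum coef_fpsXnM.
under eq_bigr do rewrite coef_fpsCM coef_fpsXn.
case: ltnP => [ltnm | lemn].
  rewrite (bigD1 (Ordinal ltnm)) //= eqxx mulr1 big1 ?addr0 // => i.
  by rewrite -val_eqE /= eq_sym => /negPf->; rewrite mulr0.
rewrite big1 ?add0r /= ?subnKC // => i _; case: eqP => [eq_ni|]; last by rewrite mulr0.
by have := ltn_ord i; rewrite -eq_ni ltnNge lemn.
Qed.

Lemma fps_dvdXn m f : (forall i, (i < m)%N -> fpscoef f i = 0) ->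
  f = fpsX k ^+ m * fps_shift m f.
Proof.
move=> f0; rewrite {1}(fps_trunc_shift m f) big1 ?add0r // => i _.
by rewrite f0 // rmorph0 mul0r.
Qed.

Lemma fps_const_shift f : f = fpsC (fps_const f) + fpsX k * fps_shift 1 f.
Proof. by rewrite {1}(fps_trunc_shift 1 f) big_ord1 !expr1 mulr1. Qed.

Lemma fpsX_neq0 : fpsX k != 0.
Proof. by apply/eqP => /fpsP/(_ 1%N)/eqP; rewrite /= oner_eq0. Qed.

End PowerSeriesTheory.

Lemma poly_taylor2 (R : comNzRingType) (F : {poly R}) (z h : R) :
  exists q, F.[z + h] = F.[z] + F^`().[z] * h + h * (h * q).
Proof.
elim/poly_ind: F => [|F c [q IH]].
  by exists 0; rewrite derivC !horner0 mul0r !mulr0 !addr0.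
exists (F^`().[z] + q * (z + h)).
by rewrite derivMXaddC !hornerE /= IH; ring.
Qed.

Section Hensel.
Variable k : fieldType.
Variables (F : {poly fps k}) (a : k).
Let F0 := map_poly (@fps_const k) F.
Hypothesis F0a : F0.[a] = 0.
Hypothesis dF0a : F0^`().[a] != 0.

(** Newton's iteration one coefficient at a time: the correction in degree
    [n'.+1] kills that coefficient of the value of [F], because by Taylor's
    formula it enters linearly with the unit factor [F0^`().[a]]. *)
Fixpoint newton n : fps k :=
  if n is n'.+1 then
    newton n' - fpsC (fpscoef F.[newton n'] n'.+1 / F0^`().[a]) * fpsX k ^+ n'.+1
  else fpsC a.

Lemma newtonS n : newton n.+1 =
  newton n - fpsC (fpscoef F.[newton n] n.+1 / F0^`().[a]) * fpsX k ^+ n.+1.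
Proof. by []. Qed.

Lemma newton_const n : fpscoef (newton n) 0 = a.
Proof.
by elim: n => // n IH; rewrite newtonS coef_fpsB coef_fpsCM coef_fpsXn mulr0 subr0.
Qed.

Lemma const_horner (G : {poly fps k}) z :
  fpscoef G.[z] 0 = (map_poly (@fps_const k) G).[fps_const z].
Proof. by rewrite horner_map. Qed.

Lemma newton_root n i : (i <= n)%N -> fpscoef F.[newton n] i = 0.
Proof.
elim: n i => [|n IH] i.
  by rewrite leqn0 => /eqP->; rewrite const_horner /fps_const /= -/(fps_const _) F0a.
rewrite newtonS; set z := newton n; set c := _ / _ => lein.
set h : fps k := - (fpsC c * fpsX k ^+ n.+1).
have [q ->] := poly_taylor2 F z h.
have hX : h = fpsX k ^+ n.+1 * fpsC (- c) by rewrite /h rmorphN mulrN mulrC.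
rewrite -/h; rewrite coef_fpsD coef_fpsD hX mulrCA -!mulrA !coef_fpsXnM.
case: ltnP => [ltin | lt_ni]; first by rewrite IH ?addr0.
have -> : i = n.+1 by apply/eqP; rewrite eqn_leq lein.
rewrite subnn mulrC !coef_fpsCM coef_fpsXnM mulr0 addr0 const_horner.
by rewrite -deriv_map /fps_const newton_const mulNr divfK // addrN.
Qed.

Lemma newton_stable n m i : (i <= n)%N ->
  fpscoef (newton (n + m)) i = fpscoef (newton n) i.
Proof.
move=> lein; elim: m => [|m IH]; first by rewrite addn0.
rewrite addnS newtonS coef_fpsB coef_fpsCM coef_fpsXn IH ltn_eqF ?mulr0 ?subr0 //.
by rewrite ltnS (leq_trans lein) ?leq_addr.
Qed.

(** The successive approximations only change in higher and higher degree, so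
    their diagonal is a root; it lifts the simple root [a] of the reduction. *)
Lemma hensel : exists z : fps k, F.[z] = 0 /\ fps_const z = a.
Proof.
pose z := Fps (fun n => fpscoef (newton n) n).
exists z; split; last exact: newton_const.
apply/fpsP => n; rewrite coef_fps0.
have zn : z = newton n + fpsX k ^+ n.+1 * fps_shift n.+1 (z - newton n).
  rewrite -fps_dvdXn; first by rewrite addrC subrK.
  move=> i; rewrite ltnS => lein; rewrite coef_fpsB [fpscoef z i]/= -(newton_stable (n - i) (leqnn i)).
  by rewrite subnKC // subrr.
set e := fpsX k ^+ n.+1 * _ in zn.
have [q] := poly_taylor2 F (newton n) e; rewrite -zn => ->.
rewrite mulrC -addrA -mulrDr coef_fpsD newton_root // add0r.
by rewrite /e -mulrA coef_fpsXnM ltnSn.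
Qed.

End Hensel.

(** * Evaluation of power series at a root of t *)

Lemma fraction_of (R : idomainType) (x : {fraction R}) :
  exists a b : R, b != 0 /\ x * FracField.tofrac b = FracField.tofrac a.
Proof.
rewrite -(@reprK _ (FracField.type R) x); move: (repr _) => {}x; exists (frac x).1, (frac x).2; split; first exact: denom_ratioP.
unlock FracField.tofrac; rewrite -[LHS]FracField.pi_mul.
apply/eqmodP; rewrite /= FracField.equivfE /FracField.mulf.
by rewrite !numden_Ratio ?mulr1 ?oner_eq0 ?denom_ratioP // mulrC.
Qed.

Section Laurent.
Variable k : fieldType.
Implicit Types (f g : fps k).

HB.instance Definition _ := GRing.RMorphism.copy (@fps_laurent k)
  (@FracField.tofrac (fps k)).
HB.instance Definition _ := GRing.RMorphism.copy (@laurentC k)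
  ((@fps_laurent k) \o (@fpsC k)).

Lemma fps_laurent_eq0 f : (fps_laurent f == 0) = (f == 0).
Proof. exact: tofrac_eq0. Qed.

Lemma laurentX_neq0 : laurentX k != 0.
Proof. by rewrite fps_laurent_eq0 fpsX_neq0. Qed.

(** Hensel's lemma for the linear polynomial [f * X - 1]. *)
Lemma fps_invertible f : fps_const f != 0 -> exists g, g * f = 1.
Proof.
move=> f0; pose F := 'X * f%:P - 1.
have [||z [Fz _]] := @hensel k F (fps_const f)^-1.
- by rewrite /F rmorphB rmorphM rmorph1 /= map_polyX map_polyC !hornerE mulVf // subrr.
- by rewrite /F rmorphB rmorphM rmorph1 /= map_polyX map_polyC !derivE !hornerE subr0.
exists z; apply/eqP; rewrite -subr_eq0 -Fz.
by rewrite /F !hornerE.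
Qed.

Lemma fps_factor f : f != 0 -> exists m g, f = fpsX k ^+ m * g /\ fps_const g != 0.
Proof.
case/fps_neq0=> m [fm fmin]; exists m, (fps_shift m f); split; first exact: fps_dvdXn.
by rewrite /fps_const /= addn0.
Qed.

(** The only non-unit factor of a denominator is a power of the variable. *)
Lemma laurentP (x : laurent k) : exists f N, x * laurentX k ^+ N = fps_laurent f.
Proof.
have [a [b [b0 xb]]] := fraction_of x; rewrite -!/(fps_laurent _) in xb.
have [m [g [def_b g0]]] := fps_factor b0; have [h hg] := fps_invertible g0.
exists (a * h), m.
rewrite rmorphM /= -xb def_b !rmorphM /= rmorphXn -!mulrA; congr (_ * _).
by rewrite -[fps_laurent g * _]rmorphM mulrC [_ * h]mulrC hg rmorph1 mul1r.
Qed.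

End Laurent.

Section RootEvaluation.
Variable k : fieldType.
Variable n : nat.
Hypothesis n_gt0 : (0 < n)%N.
Implicit Types (f g : fps k) (j m : nat).

(** The substitution of [X ^ n] for [X], the inclusion of k[[t]] in k[[X]] given
    by t = X ^ n. *)
Definition fps_subst f : fps k :=
  Fps (fun m => if (n %| m)%N then fpscoef f (m %/ n) else 0).
Definition fps_section j f : fps k := Fps (fun i => fpscoef f (i * n + j)).

Fact fps_subst_zmod_morphism : zmod_morphism fps_subst.
Proof.
by move=> f g; apply/fpsP => m /=; case: ifP => //; rewrite subr0.
Qed.

Fact fps_subst_monoid_morphism : GRing.monoid_morphism fps_subst.
Proof.
split=> [|f g]; apply/fpsP => m.
  rewrite coef_fps1 /=; case: ifP => [|nm].
    case/dvdnP=> q ->; rewrite mulnK // muln_eq0 (gtn_eqF n_gt0) orbF.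
    by case: q.
  by case: m nm => //; rewrite dvdn0.
have trunc_subst h i : (i <= m)%N ->
    fpscoef (fps_subst h) i = (fps_trunc m.+1 h \Po 'X^n)`_i.
  move=> lim; rewrite coef_comp_poly_Xn //= coef_fps_trunc.
  by rewrite ltnS (leq_trans (leq_div _ _) lim).
rewrite coef_fpsM.
under eq_bigr => i _.
  have im : (i <= m)%N by rewrite -ltnS.
  rewrite trunc_subst // (trunc_subst g) ?leq_subr //.
  over.
rewrite -coefM -comp_polyM coef_comp_poly_Xn //=.
case: ifP => // _; rewrite coefM -[in RHS]/(fps_mul _ _); apply: eq_bigr => i _.
have im : (i <= m %/ n)%N by rewrite -ltnS.
rewrite !coef_fps_trunc !ltnS (leq_trans im (leq_div m n)).
by rewrite (leq_trans (leq_subr _ _) (leq_div m n)).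
Qed.

HB.instance Definition _ :=
  GRing.isZmodMorphism.Build (fps k) (fps k) fps_subst fps_subst_zmod_morphism.
HB.instance Definition _ := GRing.isMonoidMorphism.Build (fps k) (fps k)
  fps_subst fps_subst_monoid_morphism.

Fact fps_section_zmod_morphism j : zmod_morphism (fps_section j).
Proof. by move=> f g; apply/fpsP. Qed.
HB.instance Definition _ j := GRing.isZmodMorphism.Build (fps k) (fps k)
  (fps_section j) (fps_section_zmod_morphism j).

Lemma fps_substX : fps_subst (fpsX k) = fpsX k ^+ n.
Proof.
apply/fpsP => m; rewrite coef_fpsXn /=; case: ifP => [/dvdnP[q ->]|nm].
  rewrite mulnK // -{2}[n]mul1n eqn_mul2r (gtn_eqF n_gt0) /=.
  by case: q => [|[]].
by case: eqP nm => // ->; rewrite dvdnn.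
Qed.

(** The powers [X ^ j] with [j < n] are a basis of k[[X]] over k[[X ^ n]]. *)
Lemma fps_sectionE f :
  f = \sum_(j < n) fpsX k ^+ j * fps_subst (fps_section j f).
Proof.
apply/fpsP => m; rewrite coef_fps_sum.
rewrite (bigD1 (Ordinal (ltn_pmod m n_gt0))) // big1 ?addr0.
  have em : (m - m %% n = m %/ n * n)%N by rewrite {1}(divn_eq m n) addnK.
  rewrite coef_fpsXnM [nat_of_ord _]/= ltnNge leq_mod /= em.
  by rewrite dvdn_mull // mulnK // -divn_eq addr0.
move=> j; rewrite -val_eqE => j_neq.
rewrite coef_fpsXnM; case: ltnP => // lejm /=; case: ifP => // /dvdnP[q eqm].
by case/eqP: j_neq; rewrite [RHS]/= -(subnK lejm) eqm modnMDl modn_small.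
Qed.

Lemma fps_section_subst i j f : (i < n)%N -> (j < n)%N ->
  fps_section j (fpsX k ^+ i * fps_subst f) = if i == j then f else 0.
Proof.
move=> ltin ltjn; apply/fpsP => m; rewrite [LHS]coef_fpsXnM.
have [-> | neq_ij] := eqVneq i j.
  by rewrite ltnNge leq_addl addnK /= dvdn_mull // mulnK.
rewrite coef_fps0; case: ltnP => //= le_i; case: ifP => // /dvdnP[q eqm].
case/eqP: neq_ij; rewrite -(modn_small ltin) -(modn_small ltjn).
by rewrite -(modnMDl q i) -(modnMDl m j) -eqm subnK.
Qed.

Variables (M : fieldType) (iota : {rmorphism laurent k -> M}) (w : M).
Hypothesis w_root : w ^+ n = iota (laurentX k).

(** The value at [w] of a series, when [w ^ n = t]: infinite sums have no meaning
    in [M], but the coordinates of the series over k[[t]] do. *)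
Definition root_eval f : M :=
  \sum_(j < n) w ^+ j * iota (fps_laurent (fps_section j f)).

Fact root_eval_zmod_morphism : zmod_morphism root_eval.
Proof.
move=> f g; rewrite /root_eval -sumrB; apply: eq_bigr => j _.
by rewrite (raddfB (fps_section j)) !rmorphB mulrBr.
Qed.
HB.instance Definition _ := GRing.isZmodMorphism.Build (fps k) M root_eval
  root_eval_zmod_morphism.

Lemma root_eval_monomial m f :
  root_eval (fpsX k ^+ m * fps_subst f) = w ^+ m * iota (fps_laurent f).
Proof.
rewrite (divn_eq m n) exprD mulnC exprM -fps_substX -rmorphXn mulrAC -rmorphM.
rewrite mulrC /root_eval.
have rn := ltn_pmod m n_gt0.
rewrite (bigD1 (Ordinal rn)) //= fps_section_subst // eqxx big1 ?addr0.
  rewrite exprD exprM w_root !rmorphM !rmorphXn /= -/(laurentX k) mulrCA mulrA.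
  by rewrite mulrAC.
move=> j; rewrite -val_eqE /= => neq.
by rewrite fps_section_subst // eq_sym (negPf neq) !rmorph0 mulr0.
Qed.

Fact root_eval_monoid_morphism : GRing.monoid_morphism root_eval.
Proof.
split=> [|f g].
  have := root_eval_monomial 0 1; rewrite !rmorph1 !expr0 !mul1r.
  by move=> ->.
rewrite {1}(fps_sectionE f) {1}(fps_sectionE g) mulr_suml raddf_sum mulr_suml.
apply: eq_bigr => i _; rewrite mulr_sumr raddf_sum mulr_sumr.
apply: eq_bigr => j _; rewrite mulrACA -exprD -rmorphM -[LHS]/(root_eval _) root_eval_monomial.
by rewrite !rmorphM exprD mulrACA.
Qed.

(** In other words k((w)) sits inside any extension of k((t)) that contains an
    n-th root [w] of t, and consists of k((t))-combinations of powers of [w]. *)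
Lemma root_evaluation : exists ev : {rmorphism fps k -> M},
  [/\ ev (fpsX k) = w, forall f, ev (fps_subst f) = iota (fps_laurent f)
    & forall f, ev f = \sum_(j < n) w ^+ j * iota (fps_laurent (fps_section j f))].
Proof.
pose Z := GRing.isZmodMorphism.Build (fps k) M root_eval root_eval_zmod_morphism.
pose R := GRing.isMonoidMorphism.Build (fps k) M root_eval root_eval_monoid_morphism.
pose ev : {rmorphism fps k -> M} := HB.pack root_eval Z R.
exists ev; split=> // [|f].
  have := root_eval_monomial 1 1; rewrite !rmorph1 !mulr1 !expr1.
  by move=> <-.
have := root_eval_monomial 0 f; rewrite !expr0 !mul1r.
by move=> <-.
Qed.

End RootEvaluation.

(** * Artin-Schreier theory of Laurent series *)

Section ArtinSchreierLaurent.
Variables (p : nat) (k : closedFieldType) (M : fieldType).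
Hypothesis (p_prime : prime p) (p_char : p \in [pchar k]).
Variable ev : {rmorphism fps k -> M}.
Local Notation w := (ev (fpsX k)).
Local Notation e := (ev \o @fpsC k).
Hypothesis w_neq0 : w != 0.

(** Up to a unit a nonzero series is a power of the variable. *)
Lemma series_eval_inj : injective ev.
Proof.
move=> x y /eqP; rewrite -subr_eq0 -rmorphB => evf0; apply/eqP.
rewrite -subr_eq0; apply: contraTT evf0 => /fps_factor[m [g [-> g0]]].
have [h hg] := fps_invertible g0.
rewrite rmorphM rmorphXn mulf_neq0 ?expf_neq0 //.
have : ev h * ev g != 0 by rewrite -rmorphM hg rmorph1 oner_eq0.
by rewrite mulf_eq0 negb_or => /andP[].
Qed.

(** Representatives of the quotient of Laurent series by the additive map that
    sends z to [z ^ p - z]: the exponents of the pole terms are prime to [p]. As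
    [p] divides [0], there is no constant term. *)
Definition as_reduced (phi : {poly k}) := forall i, phi`_i != 0 -> ~~ (p %| i)%N.

(** Membership in the image of k((X)), with the pole cleared. *)
Definition laurent_value (z : M) := exists h N, z = ev h / w ^+ N.

Lemma laurent_valueD y z : laurent_value y -> laurent_value z -> laurent_value (y + z).
Proof.
move=> [f [m ->]] [g [n ->]]; exists (f * fpsX k ^+ n + g * fpsX k ^+ m), (m + n)%N.
rewrite rmorphD !rmorphM !rmorphXn exprD.
have wm : w ^+ m != 0 by rewrite expf_neq0.
have wn : w ^+ n != 0 by rewrite expf_neq0.
by field; rewrite wm wn.
Qed.

Lemma laurent_valueM y z : laurent_value y -> laurent_value z -> laurent_value (y * z).
Proof.
move=> [f [m ->]] [g [n ->]]; exists (f * g), (m + n)%N.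
by rewrite rmorphM exprD invfM mulrACA.
Qed.

Lemma laurent_value_series f : laurent_value (ev f).
Proof. by exists f, 0; rewrite expr0 divr1. Qed.

(** Hensel's lemma: the derivative of [X ^ p - X - f] is [-1]. *)
Lemma fps_artin_schreier f : exists z : fps k, z ^+ p - z = f.
Proof.
have [a fa] := solve_monicpoly (fun i => if i == 0 then fps_const f else (i == 1%N)%:R)
  (prime_gt0 p_prime).
have p_gt1 := prime_gt1 p_prime.
have {fa} : a ^+ p - a = fps_const f.
  rewrite fa; case: (p) p_gt1 => [|[|q]] // _.
  rewrite !big_ord_recl /= expr0 mulr1 expr1 mul1r big1 ?addr0 => [|i _].
    by rewrite addrK.
  by rewrite mul0r.
move=> fa; pose F : {poly fps k} := 'X^p - 'X - f%:P.
have [||z [Fz _]] := @hensel k F a.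
- rewrite /F !rmorphB rmorphXn /= map_polyX map_polyC !hornerE /=.
  by rewrite fa subrr.
- rewrite /F !rmorphB rmorphXn /= map_polyX map_polyC !derivE !(hornerMn, hornerE).
  by rewrite mulrn_pchar // sub0r subr0 oppr_eq0 oner_eq0.
exists z; apply/eqP; rewrite -subr_eq0 -Fz /F !hornerE.
by [].
Qed.

(** Series without pole are of the form [z ^ p - z], and a pole of order [m * p] is
    traded for one of order [m] as k is perfect. *)
Lemma as_reduction f N : exists z phi,
  [/\ laurent_value z, as_reduced phi
    & ev f / w ^+ N = z ^+ p - z + (map_poly e phi).[w^-1]].
Proof.
have pM : p \in [pchar M] by apply: (rmorph_pchar (ev \o @fpsC k)).
elim: N f => [|N IH] f.
  have [z <-] := fps_artin_schreier f; exists (ev z), 0; split.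
  - exact: laurent_value_series.
  - by move=> i; rewrite coef0 eqxx.
  by rewrite expr0 divr1 rmorph0 horner0 addr0 rmorphB rmorphXn.
pose c := fps_const f.
have fE : ev f / w ^+ N.+1 = e c / w ^+ N.+1 + ev (fps_shift 1 f) / w ^+ N.
  rewrite {1}(fps_const_shift f) rmorphD rmorphM mulrDl exprS; congr (_ + _).
  have wN : w ^+ N != 0 by rewrite expf_neq0.
  by field; rewrite wN.
have [pN | pN] := boolP (p %| N.+1)%N; last first.
  have [z [phi [zL phiR eqz]]] := IH (fps_shift 1 f).
  exists z, (phi + c *: 'X^(N.+1)); rewrite fE eqz; split=> //.
    move=> i; rewrite coefD coefZ coefXn; case: (eqVneq i N.+1) => [-> // | _].
    by rewrite mulr0 addr0; apply: phiR.
  rewrite rmorphD /= hornerD map_polyZ map_polyXn.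
  rewrite hornerZ hornerXn exprVn; ring.
case/dvdnP: pN => m Nm.
have m_gt0 : (0 < m)%N by case: m Nm.
have lemN : (m <= N)%N.
  by rewrite -ltnS Nm -{1}[m]muln1 ltn_pmul2l // prime_gt1.
have [b bp] : exists b, b ^+ p = c.
  have [b bc] := solve_monicpoly (fun i => if i == 0 then c else 0) (prime_gt0 p_prime).
  exists b; rewrite bc; case: (p) (prime_gt0 p_prime) => // q _.
  rewrite big_ord_recl /= mulr1 big1 ?addr0 // => i _; exact: mul0r.
have [z [phi [zL phiR eqz]]] := IH (fpsC b * fpsX k ^+ (N - m) + fps_shift 1 f).
exists (e b / w ^+ m + z), phi; split=> //.
  by apply: laurent_valueD => //; exists (fpsC b), m.
rewrite fE -(pFrobenius_autE pM) rmorphD /= !pFrobenius_autE.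
have -> : ev (fps_shift 1 f) / w ^+ N = z ^+ p - z + (map_poly e phi).[w^-1] - e b / w ^+ m.
  have wNE : w ^+ N = w ^+ (N - m) * w ^+ m by rewrite -exprD subnK.
  rewrite -eqz rmorphD rmorphM rmorphXn wNE /=.
  have wm : w ^+ m != 0 by rewrite expf_neq0.
  have wNm : w ^+ (N - m) != 0 by rewrite expf_neq0.
  by field; rewrite wm wNm.
rewrite expr_div_n -exprM -Nm -!rmorphXn bp.
ring.
Qed.

(** If z has a pole then the order of the pole of [z ^ p - z] is divisible by [p],
    which a reduced polynomial in the inverse of the variable does not allow. If
    it has none then neither has the polynomial, which must be 0. *)
Lemma as_reduction_unique phi z : as_reduced phi -> laurent_value z ->
  (map_poly e phi).[w^-1] = z ^+ p - z -> phi = 0.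
Proof.
move=> phiR [h [N ->]] {z}.
have p_gt1 := prime_gt1 p_prime.
(* The polynomial in the inverse of the variable, multiplied by the D-th power. *)
pose rev D := \sum_(i < size phi) fpsC phi`_i * fpsX k ^+ (D - i).
have ev_rev D : (size phi <= D)%N -> ev (rev D) = w ^+ D * (map_poly e phi).[w^-1].
  move=> leD; rewrite rmorph_sum (@horner_coef_wide _ (size phi)) ?size_poly //.
  rewrite mulr_sumr; apply: eq_bigr => i _.
  have leiD : (i <= D)%N by rewrite (leq_trans _ leD) // ltnW.
  rewrite rmorphM rmorphXn coef_map /= -[in RHS](subnK leiD) exprD exprVn.
  have wi : w ^+ i != 0 by rewrite expf_neq0.
  by field; rewrite wi.
have coef_rev D i : (size phi <= D)%N -> (i <= D)%N -> fpscoef (rev D) (D - i) = phi`_i.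
  move=> leD leiD; rewrite coef_fps_sum.
  under eq_bigr do rewrite coef_fpsCM coef_fpsXn.
  have [lti | gei] := ltnP i (size phi); last first.
    rewrite nth_default // big1 // => j _.
    have ltjD : (j < D)%N by apply: leq_trans leD.
    have ltji : (j < i)%N by apply: leq_trans gei.
    by rewrite ltn_eqF ?mulr0 // ltn_sub2l.
  rewrite (bigD1 (Ordinal lti)) //= eqxx mulr1 big1 ?addr0 // => j.
  rewrite -val_eqE /= => neq; case: eqP => [eqD|]; last by rewrite mulr0.
  have lejD : (j <= D)%N by rewrite (leq_trans _ leD) // ltnW.
  by case/eqP: neq; rewrite -(subKn lejD) -eqD subKn.
elim: N h => [|N IH] h.
  rewrite expr0 divr1 => eqphi; pose D := size phi.
  have revE : rev D = fpsX k ^+ D * (h ^+ p - h).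
    by apply: series_eval_inj; rewrite ev_rev // eqphi !(rmorphM, rmorphXn, rmorphB).
  apply/polyP => i; rewrite coef0; apply/eqP; apply: contraT => phi_i.
  have i_gt0 : (0 < i)%N by have := phiR _ phi_i; case: (i); rewrite ?dvdn0.
  have lti : (i < D)%N by rewrite ltnNge; apply: contra phi_i => /(nth_default 0)->.
  have := coef_rev D i (leqnn _) (ltnW lti).
  rewrite revE coef_fpsXnM ltn_subrL i_gt0 (leq_trans _ lti) // => phi0.
  by rewrite -phi0 eqxx in phi_i.
move=> eqphi; have [h0 | h0] := eqVneq (fps_const h) 0.
  apply: (IH (fps_shift 1 h)); rewrite eqphi {1 2}(fps_const_shift h) h0.
  rewrite rmorph0 add0r rmorphM exprS.
  have wN : w ^+ N != 0 by rewrite expf_neq0.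
  suff -> : w * ev (fps_shift 1 h) / (w * w ^+ N) = ev (fps_shift 1 h) / w ^+ N by [].
  by field; rewrite wN.
pose D := (size phi + N.+1 * p)%N; have leD : (size phi <= D)%N by apply: leq_addr.
have leND : (N.+1 * p <= D)%N by apply: leq_addl.
have revE : fpsX k ^+ (N.+1 * p) * rev D
    = fpsX k ^+ D * (h ^+ p - fpsX k ^+ (N.+1 * p.-1) * h).
  apply: series_eval_inj; rewrite !(rmorphM, rmorphXn, rmorphB) ev_rev // eqphi.
  have eNp : (N.+1 * p = N.+1 * p.-1 + N.+1)%N.
    by rewrite -mulnSr prednK // prime_gt0.
  rewrite expr_div_n -exprM eNp (exprD _ (N.+1 * p.-1) N.+1); move: (w ^+ D) => c.
  have wN : w ^+ N.+1 != 0 by rewrite expf_neq0.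
  have wNp : w ^+ (N.+1 * p.-1) != 0 by rewrite expf_neq0.
  move: wN wNp; move: (w ^+ N.+1) (w ^+ (N.+1 * p.-1)) => a b a0 b0.
  by field; rewrite a0 b0.
have := congr1 (fun f => fpscoef f D) revE; rewrite !coef_fpsXnM ltnn ltnNge leND.
rewrite coef_rev // subnn.
have -> : phi`_(N.+1 * p) = 0.
  by apply/eqP; apply: contraT => /phiR; rewrite dvdn_mull.
have p1_gt0 : (0 < p.-1)%N by rewrite -subn1 subn_gt0.
rewrite coef_fpsB coef_fpsXnM muln_gt0 p1_gt0 subr0.
rewrite -/(fps_const (h ^+ p)) rmorphXn => /esym/eqP.
by rewrite expf_eq0 (negPf h0) andbF.
Qed.

End ArtinSchreierLaurent.

(** * Extension of automorphisms *)

Section AutomorphismExtension.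
Variables (K M : fieldType) (iota : {rmorphism K -> M}).
Hypothesis M_closure : separable_closure iota.
Implicit Types (G : set (M * M)) (a b m : {poly M}) (x y : M).

(** The graph of a K-isomorphism between two subrings of [M] that contain K. Graphs
    make the union of a chain trivial and are symmetric in domain and image.
    Injectivity and stability under inverses follow from algebraicity over K. *)
Record partial_iso G : Prop := PartialIso {
  partial_base : forall c, G (iota c, iota c);
  partialB : forall x y x' y', G (x, y) -> G (x', y') -> G (x - x', y - y');
  partialM : forall x y x' y', G (x, y) -> G (x', y') -> G (x * x', y * y');
  partial_fun : forall y, G (0, y) -> y = 0
}.

(** Divide an algebraic equation of [x] by the highest possible power of [x] and
    solve for its constant term. *)
Lemma inv_horner x : x != 0 -> exists r : {poly K}, x * (map_poly iota r).[x] = 1.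
Proof.
move=> x0; have [q [q_sep qx]] := M_closure.1 x.
have {q_sep} := separable_poly_neq0 q_sep.
elim/poly_ind: q qx => [|q c IH]; first by rewrite eqxx.
have [-> | c0] := eqVneq c 0.
  rewrite addr0 rmorphM /= map_polyX rootM mulf_eq0 polyX_eq0 orbF.
  by rewrite [root 'X x]rootE hornerX (negPf x0) orbF.
rewrite rmorphD rmorphM /= map_polyX map_polyC rootE !hornerE.
rewrite addr_eq0 => /eqP qx _; exists ((- c^-1) *: q).
rewrite map_polyZ hornerZ mulrCA [x * _]mulrC qx rmorphN fmorphV mulrNN mulVf //.
by rewrite fmorph_eq0.
Qed.

Section Theory.
Variable G : set (M * M).
Hypothesis G_iso : partial_iso G.
Let GB := partialB G_iso.
Let GM := partialM G_iso.

Lemma partial0 : G (0, 0).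
Proof. by have := partial_base G_iso 0; rewrite rmorph0. Qed.

Lemma partialN x y : G (x, y) -> G (- x, - y).
Proof. by move=> Gxy; rewrite -[- x]add0r -[- y]add0r; apply: GB partial0 Gxy. Qed.

Lemma partialD x y x' y' : G (x, y) -> G (x', y') -> G (x + x', y + y').
Proof.
by move=> Gxy Gxy'; rewrite -[x']opprK -[y']opprK; apply: GB => //; apply: partialN.
Qed.

Lemma partial_sum I (r : seq I) (F F' : I -> M) :
  (forall i, G (F i, F' i)) -> G (\sum_(i <- r) F i, \sum_(i <- r) F' i).
Proof.
move=> GF; elim: r => [|i r IH]; first by rewrite !big_nil; apply: partial0.
by rewrite !big_cons; apply: partialD.
Qed.

Lemma partialX x y n : G (x, y) -> G (x ^+ n, y ^+ n).
Proof.
move=> Gxy; elim: n => [|n IH]; last by rewrite !exprS; apply: GM.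
by have := partial_base G_iso 1; rewrite rmorph1.
Qed.

(** A polynomial over the domain of the isomorphism with its image. *)
Definition poly_pair a b := forall i, G (a`_i, b`_i).

Lemma poly_pairB a b a' b' :
  poly_pair a b -> poly_pair a' b' -> poly_pair (a - a') (b - b').
Proof. by move=> ab ab' i; rewrite !coefB; apply: GB. Qed.

Lemma poly_pairM a b a' b' :
  poly_pair a b -> poly_pair a' b' -> poly_pair (a * a') (b * b').
Proof. by move=> ab ab' i; rewrite !coefM; apply: partial_sum => j; apply: GM. Qed.

Lemma poly_pair_map (q : {poly K}) : poly_pair (map_poly iota q) (map_poly iota q).
Proof. by move=> i; rewrite coef_map; apply: partial_base. Qed.

Lemma poly_pairC x y : G (x, y) -> poly_pair x%:P y%:P.
Proof. by move=> Gxy i; rewrite !coefC; case: ifP => // _; apply: partial0. Qed.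

Lemma poly_pairX : poly_pair 'X 'X.
Proof. by have := poly_pair_map 'X; rewrite map_polyX. Qed.

Lemma poly_pair_horner a b x y : poly_pair a b -> G (x, y) -> G (a.[x], b.[y]).
Proof.
move=> ab Gxy; rewrite (horner_coef_wide _ (leq_maxl (size a) (size b))).
rewrite (horner_coef_wide _ (leq_maxr (size a) (size b))).
by apply: partial_sum => i; apply: GM => //; apply: partialX.
Qed.

Lemma partial_inj x y x' : G (x, y) -> G (x', y) -> x = x'.
Proof.
move=> Gxy Gx'y; apply/eqP; rewrite -subr_eq0; apply: contraT => /inv_horner[r xr].
have Gd := GB Gxy Gx'y.
have := GM Gd (poly_pair_horner (poly_pair_map r) Gd).
rewrite xr subrr mul0r => G10; have := GB (partial_base G_iso 1) G10.
by rewrite rmorph1 subrr subr0 => /(partial_fun G_iso)/eqP; rewrite oner_eq0.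
Qed.

Lemma partial_functional x y y' : G (x, y) -> G (x, y') -> y = y'.
Proof.
move=> Gxy Gxy'; apply/eqP; rewrite -subr_eq0; apply/eqP.
by apply: (partial_fun G_iso); rewrite -(subrr x); apply: GB.
Qed.

Lemma partialV x y : G (x, y) -> x != 0 -> G (x^-1, y^-1).
Proof.
move=> Gxy x0; have [r xr] := inv_horner x0.
have Gr := poly_pair_horner (poly_pair_map r) Gxy.
have yr : y * (map_poly iota r).[y] = 1.
  have := GM Gxy Gr; rewrite xr => /partial_functional; apply.
  by have := partial_base G_iso 1; rewrite rmorph1.
have y0 : y != 0.
  by apply/eqP => y0; move/eqP: yr; rewrite y0 mul0r eq_sym oner_eq0.
have -> : x^-1 = (map_poly iota r).[x] by apply: (mulfI x0); rewrite xr divff.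
by have -> : y^-1 = (map_poly iota r).[y] by apply: (mulfI y0); rewrite yr divff.
Qed.

Lemma partial_opposite : partial_iso [set z | G (z.2, z.1)].
Proof.
split=> /= [c | x y x' y' | x y x' y' | y].
- exact: partial_base.
- exact: GB.
- exact: GM.
by move=> Gy0; apply: partial_inj Gy0 partial0.
Qed.

(** The minimal polynomial of [x] over the domain of [G], with its image. Euclidean
    division by it takes place in both components at once. *)
Lemma minimal_pair x : exists m1 m2, [/\ poly_pair m1 m2, m1 \is monic,
   root m1 x & forall a b, poly_pair a b -> root a x ->
     exists a' b', a = a' * m1 /\ b = b' * m2].
Proof.
pose Q n := `[< exists a b, [/\ poly_pair a b, a != 0, root a x & size a = n] >].
have exQ : exists n, Q n.
  have [q [q_sep qx]] := M_closure.1 x; exists (size (map_poly iota q)).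
  apply/asboolP; exists (map_poly iota q), (map_poly iota q); split=> //.
    exact: poly_pair_map.
  by rewrite map_poly_eq0 separable_poly_neq0.
case: (ex_minnP exQ) => n /asboolP[c [d [cd c0 cx cn]]] nmin {exQ}.
pose l := (lead_coef c)^-1; pose l' := (d`_(size c).-1)^-1.
have Gl : G (l, l') by apply: partialV; [apply: cd | rewrite lead_coef_eq0].
have l0 : l != 0 by rewrite invr_eq0 lead_coef_eq0.
exists (l%:P * c), (l'%:P * d).
have cd' : poly_pair (l%:P * c) (l'%:P * d) by apply: poly_pairM => //; apply: poly_pairC.
have mon : l%:P * c \is monic.
  by rewrite monicE lead_coefM lead_coefC mulVf // lead_coef_eq0.
have mx : root (l%:P * c) x by rewrite rootM cx orbT.
split=> // a b; have [N] := ubnP (size a); elim: N a b => // N IH a b.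
rewrite ltnS => leN ab ax.
have [lt_an | le_na] := ltnP (size a) n.
  have a0 : a = 0.
    apply/eqP; apply: contraTT lt_an => a0; rewrite -leqNgt nmin //.
    by apply/asboolP; exists a, b.
  exists 0, 0; rewrite !mul0r; split=> //; apply/polyP => i.
  by have := ab i; rewrite a0 coef0 => /(partial_fun G_iso).
set m1 := l%:P * c; set m2 := l'%:P * d.
have sm : size m1 = n by rewrite /m1 mul_polyC size_scale.
have n0 : (0 < n)%N by rewrite -sm size_poly_gt0 monic_neq0.
have a0 : a != 0 by rewrite -size_poly_gt0 (leq_trans n0).
pose u := (lead_coef a)%:P * 'X^(size a - n); pose u' := (b`_(size a).-1)%:P * 'X^(size a - n).
have uu' : poly_pair u u'.
  apply: poly_pairM; first by apply: poly_pairC; apply: ab.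
  by have := poly_pair_map 'X^(size a - n); rewrite map_polyXn.
have [||| a' [b' [aE bE]]] := IH (a - u * m1) (b - u' * m2).
- apply: leq_trans leN.
  have lu0 : lead_coef a != 0 by rewrite lead_coef_eq0.
  have su : size (u * m1) = size a.
    rewrite size_Mmonic ?mulf_neq0 ?polyC_eq0 // ?expf_neq0 ?polyX_eq0 //.
    by rewrite sm /u mul_polyC size_scale // size_polyXn addSn /= subnK.
  have lE : lead_coef (u * m1) = lead_coef a.
    by rewrite lead_coef_Mmonic // lead_coefM lead_coefC lead_coefXn mulr1.
  have sle : (size (a - u * m1)%R <= size a)%N.
    by rewrite (leq_trans (size_polyD _ _)) // size_polyN su maxnn.
  rewrite ltn_neqAle sle andbT; apply: contraNneq lu0 => seq.
  have : lead_coef (a - u * m1) = 0.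
    rewrite lead_coefE seq coefB -lead_coefE -[in X in _ - X]su -lead_coefE lE.
    by rewrite subrr.
  move/eqP; rewrite (lead_coef_eq0 (a - u * m1)) => /eqP a_um; move: seq.
  by rewrite a_um size_poly0 => /esym/eqP; rewrite size_poly_eq0 lead_coef_eq0.
- by apply: poly_pairB => //; apply: poly_pairM.
- by rewrite rootE hornerD hornerN hornerM (rootP ax) (rootP mx) mulr0 subrr.
exists (a' + u), (b' + u'); split; first by rewrite mulrDl -aE subrK.
by rewrite mulrDl -bE subrK.
Qed.

Lemma minimal_pair_separable x m1 m2 : poly_pair m1 m2 -> m1 \is monic ->
  (forall a b, poly_pair a b -> root a x -> exists a' b', a = a' * m1 /\ b = b' * m2) ->
  [/\ separable_poly m1, separable_poly m2 & size m2 = size m1].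
Proof.
move=> mm mon mmin; have [q [q_sep qx]] := M_closure.1 x.
have [a [b [aE bE]]] := mmin _ _ (poly_pair_map q) qx.
have q_sep' : separable_poly (map_poly iota q) by rewrite separable_map.
split.
- by apply: dvdp_separable q_sep'; rewrite aE dvdp_mulIr.
- by apply: dvdp_separable q_sep'; rewrite bE dvdp_mulIr.
have s0 : (0 < size m1)%N by rewrite size_poly_gt0 monic_neq0.
apply/eqP; rewrite eqn_leq; apply/andP; split.
  apply/leq_sizeP => j lej; have := mm j; rewrite nth_default //.
  exact: partial_fun.
rewrite -(prednK s0) ltnNge; apply/negP => /leq_sizeP/(_ _ (leqnn _)) m20.
have := mm (size m1).-1; rewrite m20 -lead_coefE (monicP mon) => G10.
by have /eqP := partial_inj G10 partial0; rewrite oner_eq0.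
Qed.

(** An isomorphism extends to a simple extension by sending the generator to any
    root of the image of its minimal polynomial. *)
Lemma partial_adjoin x y m1 m2 : poly_pair m1 m2 -> root m2 y ->
  (forall a b, poly_pair a b -> root a x -> exists a' b', a = a' * m1 /\ b = b' * m2) ->
  exists G', [/\ partial_iso G', (G `<=` G')%classic & G' (x, y)].
Proof.
move=> mm my mmin.
exists [set z | exists a b, poly_pair a b /\ z = (a.[x], b.[y])]%classic; split.
- split=> [c | _ _ _ _ [a [b [ab [-> ->]]]] [a' [b' [ab' [-> ->]]]]
     | _ _ _ _ [a [b [ab [-> ->]]]] [a' [b' [ab' [-> ->]]]] | z [a [b [ab [ax ->]]]]].
  + exists (iota c)%:P, (iota c)%:P; rewrite !hornerC; split=> //.
    by apply: poly_pairC; apply: partial_base.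
  + by exists (a - a'), (b - b'); rewrite !hornerD !hornerN; split=> //; apply: poly_pairB.
  + by exists (a * a'), (b * b'); rewrite !hornerM; split=> //; apply: poly_pairM.
  have [|a' [b' [_ ->]]] := mmin a b ab; first by rewrite rootE -ax.
  by rewrite hornerM (rootP my) mulr0.
- move=> [x' y'] Gxy; exists x'%:P, y'%:P; rewrite !hornerC; split=> //.
  exact: poly_pairC.
by exists 'X, 'X; rewrite !hornerX; split=> //; apply: poly_pairX.
Qed.

Lemma partial_extend x : exists G' y,
  [/\ partial_iso G', (G `<=` G')%classic & G' (x, y)].
Proof.
have [m1 [m2 [mm mon m1x mmin]]] := minimal_pair x.
have [_ m2_sep sm] := minimal_pair_separable mm mon mmin.
have [|y my] := M_closure.2 m2 m2_sep.
  by rewrite sm (root_size_gt1 (monic_neq0 mon) m1x).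
by have [G' ?] := partial_adjoin mm my mmin; exists G', y.
Qed.

End Theory.

(** A graph that is maximal by Zorn's lemma has full domain by [partial_extend], and
    full image by the same lemma for the opposite graph. *)
Lemma automorphism_extension G : partial_iso G ->
  exists g : absgal iota, forall x y, G (x, y) -> g x = y.
Proof.
move=> G_iso.
(* The empty set is admitted, as it is the union of the empty chain. *)
pose P (A : set (M * M)) := (A !=set0)%classic -> partial_iso A /\ (G `<=` A)%classic.
have [|A [PA Amax]] := @Zorn_bigcup _ P.
  move=> F FP Ftot [z [X FX Xz]].
  have [X_iso GX] := FP X FX (ex_intro _ z Xz).
  have both u v : (\bigcup_(X in F) X)%classic u -> (\bigcup_(X in F) X)%classic v ->
      exists Y, [/\ F Y, partial_iso Y, Y u & Y v].
    move=> [Y FY Yu] [Z FZ Zv]; have [YZ | ZY] := Ftot Y Z FY FZ.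
      exists Z; split=> //; last exact: YZ.
      by have [] := FP Z FZ (ex_intro _ v Zv).
    exists Y; split=> //; last exact: ZY.
    by have [] := FP Y FY (ex_intro _ u Yu).
  split; last by move=> u Gu; exists X => //; apply: GX.
  split=> [c | x y x' y' Uxy Uxy' | x y x' y' Uxy Uxy' | y [Y FY Y0y]].
  - by exists X => //; apply: partial_base.
  - have [Y [FY Y_iso Yu Yv]] := both _ _ Uxy Uxy'.
    by exists Y => //; apply: (partialB Y_iso).
  - have [Y [FY Y_iso Yu Yv]] := both _ _ Uxy Uxy'.
    by exists Y => //; apply: (partialM Y_iso).
  have [Y_iso _] := FP Y FY (ex_intro _ _ Y0y).
  exact: (partial_fun Y_iso).
have A_non0 : (A !=set0)%classic.
  apply: contrapT => A0; apply: (Amax G); last by split.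
  split; first by move=> z Az; case: A0; exists z.
  by move=> GA; apply: A0; exists (iota 0, iota 0); apply: GA; apply: partial_base.
have [A_iso GA] := PA A_non0.
have maxA A' : partial_iso A' -> (A `<=` A')%classic -> (A' `<=` A)%classic.
  move=> A'_iso AA'; apply: contrapT => A'A; apply: (Amax A').
    by split.
  by split=> //; apply: subset_trans GA AA'.
have [f fP] : {f : M -> M & forall x, A (x, f x)}.
  apply: (choice (P := fun x y => A (x, y))) => x; have [A' [y [A'_iso AA' A'xy]]] := partial_extend A_iso x.
  by exists y; apply: maxA A'xy.
have [h hP] : {h : M -> M & forall y, A (h y, y)}.
  apply: (choice (P := fun y x => A (x, y))) => y.
  have [A' [x [A'_iso AA' A'yx]]] := partial_extend (partial_opposite A_iso) y.
  exists x; apply: (maxA [set z | A' (z.2, z.1)]%classic) => //.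
    exact: partial_opposite.
  by move=> [u v] Auv; apply: (AA' (v, u)).
have fE x y : A (x, y) -> f x = y by apply: (partial_functional A_iso) (fP x).
have f_zmod : zmod_morphism f.
  by move=> x y; apply: fE; apply: (partialB A_iso).
have f_monoid : GRing.monoid_morphism f.
  split=> [|x y]; last by apply: fE; apply: (partialM A_iso).
  by apply: fE; have := partial_base A_iso 1; rewrite rmorph1.
have f_bij : bijective f.
  exists h => x; last exact: fE.
  by apply: (partial_inj A_iso) (hP _) (fP _).
have f_fix c : f (iota c) = iota c by apply: fE; apply: partial_base.
by exists (AbsGal f_zmod f_monoid f_bij f_fix) => x y /GA/fE.
Qed.

(** The half of the Galois correspondence that produces automorphisms: an element
    outside the subring [S] has a conjugate over [S] other than itself, by
    separability, and the isomorphism exchanging them extends to [M]. *)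
Lemma fixed_by_stabilizer (S : set M) x :
  (forall c, S (iota c)) -> (forall y z, S y -> S z -> S (y - z)) ->
  (forall y z, S y -> S z -> S (y * z)) ->
  (forall g : absgal iota, (forall y, S y -> g y = y) -> g x = x) -> S x.
Proof.
move=> Sc SB SM Sfix; apply: contrapT => Sx.
pose G := [set z : M * M | S z.1 /\ z.2 = z.1]%classic.
have G_iso : partial_iso G.
  split=> [c | y _ z _ [/= Sy ->] [/= Sz ->] | y _ z _ [/= Sy ->] [/= Sz ->] | y [] //].
  - by split=> //; apply: Sc.
  - by split=> //; apply: SB.
  - by split=> //; apply: SM.
have [m1 [m2 [mm mon m1x mmin]]] := minimal_pair G_iso x.
have [m1_sep _ _] := minimal_pair_separable G_iso mm mon mmin.
have m21 : m2 = m1 by apply/polyP => i; case: (mm i).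
have /factor_theorem[b bE] := m1x.
have b0 : b != 0.
  by apply: contraTneq mon => b0; rewrite bE b0 mul0r monicE lead_coef0 eq_sym oner_eq0.
have sm : size m1 = (size b).+1 by rewrite bE size_Mmonic ?monicXsubC // size_XsubC addn2.
move: (m1_sep); rewrite bE separable_root => /andP[b_sep bx].
have sb : (1 < size b)%N.
  rewrite ltnNge; apply/negP => sb; apply: Sx.
  have sb1 : size b = 1 by apply/eqP; rewrite eqn_leq sb size_poly_gt0.
  have [m1_0 _] := mm 0; have [m1_1 _] := mm 1.
  have : m1.[x] = 0 by apply/rootP.
  rewrite horner_coef sm sb1 !big_ord_recl big_ord0 addr0 expr0 mulr1 expr1.
  have -> : m1`_1 = 1 by move: (monicP mon); rewrite lead_coefE sm sb1.
  rewrite mul1r => /eqP; rewrite addrC addr_eq0 => /eqP->.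
  have S0 : S 0 by have := Sc 0; rewrite rmorph0.
  by rewrite -[- _]add0r; apply: SB.
have [y by0] := M_closure.2 b b_sep sb.
have [|G' [G'_iso GG' G'xy]] := partial_adjoin G_iso (y := y) mm _ mmin.
  by rewrite m21 bE rootM by0.
have [g gP] := automorphism_extension G'_iso.
have gx : g x = x by apply: Sfix => z Sz; apply: gP; apply: GG'.
by move: bx; rewrite -{1}gx (gP _ _ G'xy) by0.
Qed.

End AutomorphismExtension.

(** * Galois action and additive Hilbert 90 *)

HB.instance Definition _ (K L : fieldType) (iota : K -> L) (g : absgal iota) :=
  GRing.isZmodMorphism.Build L L (absgal_fun g) (absgal_zmod g).
HB.instance Definition _ (K L : fieldType) (iota : K -> L) (g : absgal iota) :=
  GRing.isMonoidMorphism.Build L L (absgal_fun g) (absgal_monoid g).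

Section GaloisAction.
Variables (K M : fieldType) (iota : {rmorphism K -> M}).
Implicit Types (g h : absgal iota) (x y : M).

Lemma absgalM g h x : (g * h)%g x = g (h x).
Proof. by []. Qed.

Lemma absgalK g x : g^-1%g (g x) = x.
Proof. by rewrite -absgalM mulVg. Qed.

Lemma absgalVK g x : g (g^-1%g x) = x.
Proof. by rewrite -absgalM mulgV. Qed.

Lemma absgalV_fix g x : g x = x -> g^-1%g x = x.
Proof. by move=> {1}<-; rewrite absgalK. Qed.

Lemma absgal_root (q : {poly K}) g x :
  root (map_poly iota q) (g x) = root (map_poly iota q) x.
Proof.
suff gq : g (map_poly iota q).[x] = (map_poly iota q).[g x].
  by rewrite !rootE -gq fmorph_eq0.
rewrite -horner_map /= -map_poly_comp; congr (_.[_]).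
by apply: eq_map_poly => c /=; apply: absgal_fix.
Qed.

Lemma root_seq (F : fieldType) (q : {poly F}) : q != 0 ->
  exists s : seq F, forall x : F, root q x -> x \in s.
Proof.
have [n] := ubnP (size q); elim: n q => // n IH q; rewrite ltnS => leqn q0.
have [[x qx] | nroot] := pselect (exists x : F, root q x); last first.
  by exists [::] => x qx; case: nroot; exists x.
have /factor_theorem[b bE] := qx.
have b0 : b != 0 by apply: contraNneq q0 => b0; rewrite bE b0 mul0r.
have [|s sP] := IH b _ b0.
  by apply: leq_trans leqn; rewrite bE size_Mmonic ?monicXsubC // size_XsubC addn2.
exists (x :: s) => y; rewrite bE rootM root_XsubC inE => /orP[/sP->|->] //.
by rewrite orbT.
Qed.

Hypothesis M_closure : separable_closure iota.

Lemma conjugate_seq x : exists s : seq M, forall g, g x \in s.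
Proof.
have [q [q_sep qx]] := M_closure.1 x.
have [|s sP] := @root_seq _ (map_poly iota q).
  by rewrite map_poly_eq0 separable_poly_neq0.
by exists s => g; apply: sP; rewrite absgal_root.
Qed.

Hypothesis K_infinite : forall s : seq M, exists c, iota c \notin s.

(** The usual choice [x + c * y] with [c] outside the finite set of quotients of
    differences of conjugates. *)
Lemma primitive_element (s : seq M) :
  exists z, forall g, g z = z -> forall y, y \in s -> g y = y.
Proof.
elim: s => [|x s [y yP]]; first by exists 0.
have [sx sxP] := conjugate_seq x; have [sy syP] := conjugate_seq y.
have [c cP] := K_infinite [seq (x' - x) / (y - y') | x' <- sx, y' <- sy].
exists (x + iota c * y) => g; rewrite rmorphD rmorphM /= absgal_fix => gz.
have ey : g y = y.
  apply/eqP; apply: contraT; rewrite -subr_eq0 -oppr_eq0 opprB => y0.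
  case/negP: cP; apply/allpairsP; exists (g x, g y); split=> //=.
  have -> : g x = x + iota c * y - iota c * g y by rewrite -gz addrK.
  by apply: (mulIf y0); rewrite divfK //; ring.
have gx : g x = x by move: gz; rewrite ey => /addIr.
by move=> y'; rewrite inE => /predU1P[-> | /(yP _ ey)].
Qed.

(** If all power sums vanished then so would the sum of the values of any polynomial,
    for instance of one that vanishes at all the points but one. *)
Lemma power_sum_neq0 (F : fieldType) (s : seq F) : uniq s -> s != [::] ->
  exists j, \sum_(x <- s) x ^+ j != 0.
Proof.
case: s => // x s /= /andP[xs _] _; apply: contrapT => sum0.
pose f := \prod_(y <- s) ('X - y%:P).
have : \sum_(y <- x :: s) f.[y] = 0.
  under eq_bigr do rewrite horner_coef.
  rewrite exchange_big big1 //= => j _.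
  rewrite -mulr_sumr; apply/eqP; rewrite mulf_eq0; apply/orP; right.
  by apply: contrapT => /negP ?; apply: sum0; exists j.
rewrite big_cons big_seq big1 ?addr0 => [/eqP | y ys].
  by rewrite -[_ == 0]/(root f x) root_prod_XsubC (negPf xs).
by apply/rootP; rewrite root_prod_XsubC.
Qed.

Variable P : set (absgal iota).
Hypotheses (P1 : P 1%g) (PM : forall g h, P g -> P h -> P (g * h)%g)
  (PV : forall g, P g -> P g^-1%g).

(** Triviality of a continuous cocycle. A primitive element [z] for [s] has a finite
    orbit under [P] on which the cocycle is well defined, the element sending [z]
    to a conjugate determining its value. Some power [z ^ j] has a nonzero trace
    [T] over this orbit, and the cocycle is the coboundary of minus the sum of
    [a g * g (z ^ j) / T]. *)
Lemma hilbert90 (a : absgal iota -> M) (s : seq M) :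
  (forall g h, P g -> P h -> a (g * h)%g = a g + g (a h)) ->
  (forall g, P g -> (forall y, y \in s -> g y = y) -> a g = 0) ->
  exists y, forall g, P g -> g y - y = a g.
Proof.
move=> aM a_s; have [z zP] := primitive_element s.
have [t tP] := conjugate_seq z.
pose O := undup [seq y <- t | `[< exists2 g, P g & g z = y >]].
have OP y : reflect (exists2 g, P g & g z = y) (y \in O).
  rewrite mem_undup mem_filter; apply: (iffP andP) => [[/asboolP //] | [g Pg gz]].
  by split; [apply/asboolP; exists g | rewrite -gz].
have O_uniq : uniq O by apply: undup_uniq.
have O_perm g : P g -> perm_eq (map g O) O.
  move=> Pg; apply: uniq_perm => //.
    by rewrite map_inj_uniq //; apply: fmorph_inj.
  move=> y; apply/mapP/idP => [[_ /OP[h Ph <-] ->] | /OP[h Ph hz]].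
    by apply/OP; exists (g * h)%g => //; apply: PM.
  exists (g^-1%g y); last by rewrite absgalVK.
  apply/OP; exists (g^-1 * h)%g; first by apply: PM => //; apply: PV.
  by rewrite absgalM hz.
have sumP g (F : M -> M) : P g -> \sum_(y <- O) F (g y) = \sum_(y <- O) F y.
  by move=> Pg; rewrite -[RHS](perm_big _ (O_perm g Pg)) big_map.
have [A AP] : {A : M -> M & forall y, y \in O -> forall g, P g -> g z = y -> A y = a g}.
  apply: (choice (P := fun y b => y \in O -> forall g, P g -> g z = y -> b = a g)) => y.
  have [/OP[h Ph hz] | nO] := boolP (y \in O); last by exists 0.
  exists (a h) => _ g Pg gz.
  have Pn : P (h^-1 * g)%g by apply: PM => //; apply: PV.
  rewrite -[in RHS](mulKVg h g) aM // (a_s (h^-1 * g)%g) ?rmorph0 ?addr0 // => x xs.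
  by apply: zP => //; rewrite absgalM gz -hz absgalK.
have [|j Tj] := power_sum_neq0 O_uniq.
  have : z \in O by apply/OP; exists 1%g.
  by case: (O).
set T := \sum_(y <- O) _ in Tj.
exists (- T^-1 * \sum_(y <- O) A y * y ^+ j) => g Pg.
have gT : g T = T.
  rewrite rmorph_sum /= -[RHS](sumP g) //; apply: eq_bigr => y _.
  by rewrite rmorphXn.
have gS : g (\sum_(y <- O) A y * y ^+ j) = \sum_(y <- O) A y * y ^+ j - a g * T.
  rewrite rmorph_sum -(sumP g (fun y => A y * y ^+ j)) // -{1}gT /T rmorph_sum mulr_sumr.
  rewrite -sumrB big_seq [RHS]big_seq; apply: eq_bigr => y /OP[h Ph hz].
  rewrite rmorphM rmorphXn /= -mulrBl; congr (_ * _).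
  have yO : y \in O by apply/OP; exists h.
  have gyO : g y \in O by apply/OP; exists (g * h)%g; rewrite ?absgalM ?hz //; apply: PM.
  rewrite (AP y yO h) // (AP (g y) gyO (g * h)%g) ?absgalM ?hz //; last exact: PM.
  by rewrite aM // addrC addKr.
rewrite rmorphM rmorphN fmorphV /= gT gS.
by field.
Qed.

End GaloisAction.

(** * Integers of a tamely ramified extension *)

Section TameExtension.
Variables (p : nat) (k : closedFieldType) (L : fieldExtType (laurent k)).
Hypothesis p_char : p \in [pchar k].
Implicit Types (x y z : L) (f : fps k) (c : k).

Definition fps_alg : fps k -> L := in_alg L \o @fps_laurent k.
HB.instance Definition _ := GRing.RMorphism.copy fps_alg (in_alg L \o @fps_laurent k).
Local Notation t := (fps_alg (fpsX k)).

Lemma intring_fps f : intring (fps_alg f).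
Proof. exact: (integral_id fps_alg). Qed.
Lemma intring1 : intring (1 : L).
Proof. exact: (integral1 fps_alg). Qed.
Lemma intringD x y : intring x -> intring y -> intring (x + y).
Proof. exact: (@integral_add _ _ fps_alg). Qed.
Lemma intringB x y : intring x -> intring y -> intring (x - y).
Proof. exact: (@integral_sub _ _ fps_alg). Qed.
Lemma intringM x y : intring x -> intring y -> intring (x * y).
Proof. exact: (@integral_mul _ _ fps_alg). Qed.
Lemma intringX x n : intring x -> intring (x ^+ n).
Proof.
by move=> x_int; elim: n => [|n IH]; [apply: intring1 | rewrite exprS; apply: intringM].
Qed.
Lemma intring_sum I (r : seq I) (F : I -> L) :
  (forall i, intring (F i)) -> intring (\sum_(i <- r) F i).
Proof.
move=> F_int; elim/big_rec: _ => [|i x _]; last exact: intringD.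
by rewrite -(rmorph0 fps_alg); apply: intring_fps.
Qed.

Lemma fps_alg_eq0 f : (fps_alg f == 0) = (f == 0).
Proof. by rewrite fmorph_eq0 fps_laurent_eq0. Qed.

Lemma fps_alg_unif_neq0 : t != 0.
Proof. by rewrite fps_alg_eq0 fpsX_neq0. Qed.

(** Scaling a root by [t ^ N] multiplies the lower coefficients of its monic
    equation by positive powers of [t ^ N], which clears their poles. *)
Lemma intring_denominator x : exists N, intring (t ^+ N * x).
Proof.
have [/polyOver1P[q Dq]] := (minPolyOver 1 x, monic_minPoly 1 x).
rewrite Dq map_monic => q_mon.
have qx : root (map_poly (in_alg L) q) x by rewrite -Dq root_minPoly.
have [N NP] : exists N, forall i, exists f, q`_i * laurentX k ^+ N = fps_laurent f.
  suff [N NP] : exists N, forall i, (i < size q)%N ->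
      exists f, q`_i * laurentX k ^+ N = fps_laurent f.
    exists N => i; have [/NP // | lti] := ltnP i (size q).
    by exists 0; rewrite nth_default // mul0r rmorph0.
  elim: (size q) => [|n [N NP]]; first by exists 0.
  have [f [m fm]] := laurentP q`_n; exists (N + m)%N => i.
  rewrite ltnS leq_eqVlt => /predU1P[-> | /NP[g gN]].
    exists (f * fpsX k ^+ N).
    by rewrite addnC exprD mulrA fm rmorphM rmorphXn.
  by exists (g * fpsX k ^+ m); rewrite exprD mulrA gN rmorphM rmorphXn.
exists N; set d := (size q).-1.
have sq : size q = d.+1 by rewrite prednK // size_poly_gt0 monic_neq0.
pose Q : {poly L} := \poly_(i < d.+1) ((q`_i)%:A * t ^+ (N * (d - i))).
have Qd : Q`_d = 1.
  rewrite coef_poly ltnSn subnn muln0 expr0 mulr1.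
  by move: (monicP q_mon); rewrite lead_coefE -/d => ->; rewrite scale1r.
have sQ : size Q = d.+1.
  apply/eqP; rewrite eqn_leq size_poly /= ltnNge; apply/negP => /leq_sizeP/(_ _ (leqnn _)).
  by rewrite Qd => /eqP; rewrite oner_eq0.
apply: (@integral_root_monic _ _ fps_alg _ Q).
- by rewrite monicE lead_coefE sQ Qd.
- rewrite rootE (horner_coef_wide _ (eq_leq sQ)).
  have -> : \sum_(i < d.+1) Q`_i * (t ^+ N * x) ^+ i =
      t ^+ (N * d) * (map_poly (in_alg L) q).[x].
    rewrite horner_coef size_map_poly sq mulr_sumr; apply: eq_bigr => i _.
    have -> : t ^+ (N * d) = t ^+ (N * (d - i)) * t ^+ (N * i).
      by rewrite -exprD -mulnDr subnK // -ltnS; apply: ltn_ord.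
    rewrite coef_poly ltn_ord coef_map exprMn -exprM.
    by rewrite -!mulrA mulrCA; congr (_ * _); rewrite mulrCA.
  by rewrite (rootP qx) mulr0.
apply/integral_poly => i; rewrite coef_poly; case: ltnP => lti; last first.
  exact: (integral0 fps_alg).
have [-> | neq_id] := eqVneq i d.
  rewrite subnn muln0 expr0 mulr1.
  move: (monicP q_mon); rewrite lead_coefE -/d => ->; rewrite scale1r.
  exact: (integral1 fps_alg).
have lt_id : (i < d)%N by rewrite ltn_neqAle neq_id -ltnS.
have [f fE] := NP i.
have -> : (q`_i)%:A * t ^+ (N * (d - i)) = fps_alg (f * fpsX k ^+ (N * (d - i.+1))).
  rewrite -(subnSK lt_id) mulnS exprD mulrA rmorphM rmorphXn; congr (_ * _).
  by rewrite -[RHS]/(in_alg L (fps_laurent f)) -fE rmorphM rmorphXn.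
exact: (integral_id fps_alg).
Qed.

Variables (pi y0 z0 : L) (e' : nat).
Local Notation e := e'.+1.
Hypotheses (pi_unif : uniformizer pi) (y0_int : intring y0) (z0_int : intring z0).
Hypotheses (yz0 : y0 * z0 = 1) (tE : t = pi ^+ e * y0).

Lemma pi_int : intring pi. Proof. by case: pi_unif => -[]. Qed.

Lemma pi_nonunit z : intring z -> pi * z != 1.
Proof.
move=> z_int; apply/eqP => piz.
by case: pi_unif => -[_ nu] _; apply: nu; exists z.
Qed.

Lemma t_nonunit z : intring z -> t * z != 1.
Proof.
move=> z_int; rewrite tE exprS -!mulrA; apply: pi_nonunit.
by do !apply: intringM => //; apply: intringX; apply: pi_int.
Qed.

(** Some [t ^ N / x] is integral, so if [x] were divisible by [t ^ N.+1] then [t]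
    would be a unit. *)
Lemma intring_separated x :
  (forall N, exists y, intring y /\ x = t ^+ N * y) -> x = 0.
Proof.
move=> xN; apply/eqP; apply: contraT => x0.
have [N Nint] := intring_denominator x^-1; have [y [y_int xy]] := xN N.+1.
have /eqP : t * (y * (t ^+ N * x^-1)) = 1.
  rewrite -(divff x0) [X in _ = X * _]xy exprS; ring.
by rewrite (negPf (t_nonunit (intringM y_int Nint))).
Qed.

(** The residue field is k: modulo t a monic equation of [x] has coefficients in
    k, hence splits, so the product of the [x - c] over its roots lies in the
    maximal ideal, and so does one of the factors. *)
Lemma residue x : intring x ->
  exists c x', intring x' /\ x = fps_alg (fpsC c) + pi * x'.
Proof.
move=> x_int; have [F F_mon Fx] := x_int.
pose F0 := map_poly (@fps_const k) F.
have [s sE] := closed_field_poly_normal F0.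
have F0_mon : F0 \is monic by apply: monic_map.
rewrite (monicP F0_mon) scale1r in sE.
pose F1 := map_poly (fps_shift 1) F.
have F1_int : intring (map_poly fps_alg F1).[x].
  apply: (@integral_horner _ _ fps_alg) => //; apply/integral_poly => i.
  by rewrite coef_map; apply: (integral_id fps_alg).
have FE : map_poly fps_alg F = map_poly (fps_alg \o @fpsC k) F0 + t *: map_poly fps_alg F1.
  apply/polyP => i; rewrite coefD coefZ !coef_map /= -rmorphM -rmorphD.
  by rewrite [in LHS](fps_const_shift F`_i) coef_map_id0 //; apply/fpsP.
have prodE : \prod_(c <- s) (x - fps_alg (fpsC c)) = - (t * (map_poly fps_alg F1).[x]).
  apply/eqP; rewrite eq_sym eqr_oppLR -subr_eq0 opprK addrC; apply/eqP.
  rewrite -[RHS](rootP Fx) -[(fun f => _)]/fps_alg FE hornerD hornerZ; congr (_ + _).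
  rewrite sE rmorph_prod horner_prod; apply: eq_bigr => c _.
  by rewrite rmorphB /= map_polyX map_polyC !hornerE.
have [[c [cs nunit]] | unit] :=
    pselect (exists c, c \in s /\ ~ exists2 y, intring y & (x - fps_alg (fpsC c)) * y = 1).
  have [_ /(_ (x - fps_alg (fpsC c)))[]] := pi_unif.
    by split=> //; apply: intringB => //; apply: intring_fps.
  by move=> y y_int xE; exists c, y; split=> //; rewrite -xE addrC subrK.
have [y y_int yE] : exists2 y, intring y & \prod_(c <- s) (x - fps_alg (fpsC c)) * y = 1.
  have {}unit c : c \in s -> exists2 y, intring y & (x - fps_alg (fpsC c)) * y = 1.
    by move=> cs; apply: contrapT => nunit; apply: unit; exists c.
  elim: (s) unit => [|c r IH] unit; first by exists 1; rewrite ?big_nil ?mul1r //; apply: intring1.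
  have [c' c's | y y_int yE] := IH; first by apply: unit; rewrite inE c's orbT.
  have [z z_int zE] := unit c (mem_head _ _).
  exists (z * y); first exact: intringM.
  by rewrite big_cons mulrACA zE mul1r.
move: yE; rewrite prodE mulNr -mulrN -mulrA => /eqP; rewrite (negPf (t_nonunit _)) //.
apply: intringM => //.
by rewrite -[- y]add0r -(rmorph0 fps_alg); apply: intringB => //; apply: intring_fps.
Qed.

(** Since [pi ^ e] and [t] differ by a unit, [e] digits in base [pi] give one
    digit in base [t]. *)
Lemma digits x : intring x -> exists (c : nat -> k) x',
  intring x' /\ x = \sum_(i < e) pi ^+ i * fps_alg (fpsC (c i)) + t * x'.
Proof.
move=> x_int; suff [c [x' [x'_int xE]]] : exists (c : nat -> k) x',
    intring x' /\ x = \sum_(i < e) pi ^+ i * fps_alg (fpsC (c i)) + pi ^+ e * x'.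
  exists c, (z0 * x'); split; first exact: intringM.
  by rewrite tE mulrA -[_ * y0 * z0]mulrA yz0 mulr1.
elim: e => [|n [c [x' [x'_int xE]]]].
  by exists (fun=> 0), x; rewrite big_ord0 add0r mul1r.
have [a [x'' [x''_int x'E]]] := residue x'_int.
exists (fun i => if i == n then a else c i), x''; split=> //.
rewrite big_ord_recr /= eqxx xE x'E mulrDr !addrA mulrA -exprSr; congr (_ + _ + _).
by apply: eq_bigr => i _; rewrite ltn_eqF.
Qed.

(** The ring of integers is generated over k[[t]] by [1, pi, .., pi ^ (e - 1)].
    Iterating [digits] yields the power series that should be the coordinates,
    and the error is divisible by every power of [t]. This is where the
    completeness of k[[t]] enters. *)
Lemma intring_basis x : intring x -> exists f : nat -> fps k,
  x = \sum_(i < e) pi ^+ i * fps_alg (f i).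
Proof.
move=> x_int.
have [D DP] : {D : L -> (nat -> k) * L & forall x, intring x ->
    intring (D x).2 /\ x = \sum_(i < e) pi ^+ i * fps_alg (fpsC ((D x).1 i)) + t * (D x).2}.
  apply: (choice (P := fun x (d : (nat -> k) * L) => intring x ->
    intring d.2 /\ x = \sum_(i < e) pi ^+ i * fps_alg (fpsC (d.1 i)) + t * d.2)) => y.
  have [y_int | y_nint] := pselect (intring y); last by exists (fun=> 0, 0).
  by have [c [y' ?]] := digits y_int; exists (c, y').
pose X n := iter n (fun y => (D y).2) x.
have X_int n : intring (X n) by elim: n => //= n /DP[].
pose f i := Fps (fun n => (D (X n)).1 i).
exists f; apply/eqP; rewrite -subr_eq0; apply/eqP; apply: intring_separated => N.
exists (X N - \sum_(i < e) pi ^+ i * fps_alg (fps_shift N (f i))); split.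
  apply: intringB => //; apply: intring_sum => i; apply: intringM; last exact: intring_fps.
  exact: intringX pi_int.
elim: N => [|N IH].
  by rewrite mul1r; congr (_ - _); apply: eq_bigr => i _; congr (_ * fps_alg _).
rewrite IH exprSr -mulrA; congr (_ * _).
have [_ XE] := DP _ (X_int N).
suff SE : \sum_(i < e) pi ^+ i * fps_alg (fps_shift N (f i)) =
    \sum_(i < e) pi ^+ i * fps_alg (fpsC ((D (X N)).1 i)) +
    t * \sum_(i < e) pi ^+ i * fps_alg (fps_shift N.+1 (f i)).
  by rewrite SE [X in X - _]XE -[X N.+1]/((D (X N)).2); ring.
rewrite mulr_sumr -big_split; apply: eq_bigr => i _ /=.
rewrite mulrCA -mulrDr -rmorphM -rmorphD; congr (_ * fps_alg _).
rewrite [LHS](fps_const_shift (fps_shift N (f i))).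
have -> : fps_const (fps_shift N (f i)) = (D (X N)).1 i.
  by rewrite /fps_const /= addn0.
by congr (_ + _ * _); apply/fpsP => j /=; rewrite add1n addnS.
Qed.

(** The Eisenstein equation of the uniformizer: [pi ^ e / t] is a unit, so its
    coordinate on [1] has a nonzero constant term. *)
Lemma eisenstein : exists f : nat -> fps k,
  fps_const (f 0) != 0 /\ pi ^+ e = t * \sum_(i < e) pi ^+ i * fps_alg (f i).
Proof.
have [f fE] := intring_basis z0_int; exists f; split; last first.
  by rewrite -fE tE -mulrA yz0 mulr1.
apply/eqP => f0.
have : pi * (y0 * (pi ^+ e' * y0 * fps_alg (fps_shift 1 (f 0))
     + \sum_(i < e') pi ^+ i * fps_alg (f i.+1))) = 1.
  rewrite -yz0 mulrCA; congr (_ * _).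
  rewrite fE big_ord_recl mul1r mulrDr !mulrA -exprS -tE -rmorphM.
  rewrite {2}(fps_const_shift (f 0)) f0 rmorph0 add0r; congr (_ + _).
  by rewrite mulr_sumr; apply: eq_bigr => i _; rewrite mulrA -exprS.
move/eqP; rewrite (negPf (pi_nonunit _)) //.
apply: intringM => //; apply: intringD.
  by do !apply: intringM => //; [apply: intringX; apply: pi_int | apply: intring_fps].
apply: intring_sum => i; apply: intringM; last exact: intring_fps.
exact: intringX pi_int.
Qed.

End TameExtension.

(** * Roots of t control the wild inertia *)

Section WildInertia.
Variables (p : nat) (k : closedFieldType).
Hypotheses (p_prime : prime p) (p_char : p \in [pchar k]).
Variables (Ksep : fieldType) (iota : {rmorphism laurent k -> Ksep}).
Hypothesis Ksep_closure : separable_closure iota.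
Local Notation t := (iota (laurentX k)).

Lemma Ksep_char : p \in [pchar Ksep].
Proof. exact: (rmorph_pchar (iota \o @laurentC k)). Qed.

Lemma natf_neq0_prime_to (F : fieldType) n : p \in [pchar F] -> ~~ (p %| n)%N -> n%:R != 0 :> F.
Proof. by move=> pF; rewrite (dvdn_pcharf pF). Qed.

Lemma separable_XnsubC (F : fieldType) n (a : F) : (0 < n)%N -> n%:R != 0 :> F ->
  a != 0 -> separable_poly ('X^n - a%:P).
Proof.
move=> n_gt0 n0 a0; rewrite separable_poly.unlock; apply/Bezout_eq1_coprimepP.
exists (- a^-1%:P, (n%:R * a)^-1 *: 'X).
rewrite derivB derivC subr0 derivXn -scaler_nat -scalerAl -scalerAr -exprS prednK //.
have -> : (n%:R * a)^-1 *: (n%:R *: 'X^n) = a^-1 *: 'X^n :> {poly F}.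
  by rewrite scalerA; rewrite invfM mulrAC mulVf // mul1r.
by rewrite mulNr mulrBr -polyCM mulVf // mul_polyC opprB subrK.
Qed.

Lemma root_exists n (a : Ksep) : (0 < n)%N -> ~~ (p %| n)%N -> a != 0 ->
  exists w, w ^+ n = a.
Proof.
move=> n_gt0 pn a0.
have [||w] := Ksep_closure.2 ('X^n - a%:P).
- by apply: separable_XnsubC => //; apply: natf_neq0_prime_to pn; apply: Ksep_char.
- by rewrite size_XnsubC // ltnS.
by rewrite rootE !hornerE subr_eq0 => /eqP; exists w.
Qed.

(** The reduction of such an equation is [X ^ e - c] with [c] nonzero and [e] prime
    to the characteristic. It has [e] simple roots, which Hensel's lemma lifts to
    power series, and these are all the roots. *)
Lemma eisenstein_series_root (ev : {rmorphism fps k -> Ksep}) e (eta : Ksep) (f : nat -> fps k) :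
  ev (fpsX k) != 0 -> (0 < e)%N -> ~~ (p %| e)%N -> fps_const (f 0) != 0 ->
  eta ^+ e = \sum_(i < e) ev (fpsX k ^+ i * f i) * eta ^+ i ->
  exists z, eta = ev z.
Proof.
move=> w0 e_gt0 pe f0 eta_root.
pose G := 'X^e - \poly_(i < e) (fpsX k ^+ i * f i).
have sG : size G = e.+1.
  by rewrite size_polyDl size_polyXn // size_polyN ltnS size_poly.
have G_mon : G \is monic.
  by rewrite monicE lead_coefDl ?lead_coefXn // size_polyXn size_polyN ltnS size_poly.
pose c := fps_const (f 0).
have GE : map_poly (@fps_const k) G = 'X^e - c%:P.
  rewrite rmorphB /= map_polyXn; congr (_ - _).
  apply/polyP => i; rewrite coef_map coef_poly coefC /=.
  case: i => [|i]; first by rewrite e_gt0 expr0 mul1r.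
  case: ifP => _ //.
  by rewrite exprS -mulrA rmorphM /= /fps_const /= mul0r.
have [s sE] := closed_field_poly_normal ('X^e - c%:P).
have lc1 : lead_coef ('X^e - c%:P) = 1 by apply/eqP/monicXnsubC.
rewrite lc1 scale1r in sE.
have ek : e%:R != 0 :> k by apply: natf_neq0_prime_to pe.
have s_sep : separable_poly ('X^e - c%:P) by apply: separable_XnsubC.
have s_uniq : uniq s by rewrite -separable_prod_XsubC -sE.
have ss : size s = e.
  by have := congr1 (fun q : {poly k} => size q) sE; rewrite size_XnsubC // size_prod_XsubC => -[].
have [Z ZP] : {Z : k -> fps k & forall a, a \in s -> G.[Z a] = 0 /\ fps_const (Z a) = a}.
  apply: (choice (P := fun a z => a \in s -> G.[z] = 0 /\ fps_const z = a)) => a.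
  have [as_ | nas] := boolP (a \in s); last by exists 0.
  have ra : root ('X^e - c%:P) a by rewrite sE root_prod_XsubC.
  have [||z [Gz za]] := @hensel k G a; last by exists z.
    by rewrite GE; apply/rootP.
  rewrite GE; move: s_sep; rewrite separable_poly.unlock => cop.
  by have := coprimep_root cop ra.
pose rs := [seq ev (Z a) | a <- s].
have [eta_rs | n_rs] := boolP (eta \in rs).
  by have /mapP[a _ ->] := eta_rs; exists (Z a).
have := @max_poly_roots _ (map_poly ev G) (eta :: rs).
rewrite size_map_poly_id0; last by rewrite (monicP G_mon) rmorph1 oner_eq0.
rewrite sG /= size_map ss ltnn => absurd; suff: false by []; apply: absurd.
- by apply: monic_neq0; apply: monic_map.
- apply/andP; split.
    rewrite rootE rmorphB /= map_polyXn hornerD hornerN hornerXn eta_root subr_eq0.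
    rewrite (@horner_coef_wide _ e); last first.
      by apply: leq_trans (size_poly _ _) (size_poly _ _).
    by apply/eqP; apply: eq_bigr => i _; rewrite coef_map coef_poly ltn_ord.
  apply/allP => _ /mapP[a /ZP[Ga _] ->].
  by rewrite rootE horner_map Ga rmorph0.
- rewrite n_rs map_inj_in_uniq // => a b /ZP[_ {2}<-] /ZP[_ {2}<-].
by move=> /(series_eval_inj w0) ->.
Qed.

(** A tame extension with ramification index [e] is contained in k((w)) for any [w]
    with [w ^ e = t]: the quotient of its uniformizer by [w] satisfies the equation
    of [eisenstein_series_root], and the uniformizer generates the extension by
    [intring_basis]. *)
Lemma tame_roots_fixed (g : absgal iota) :
  (forall n w, (0 < n)%N -> ~~ (p %| n)%N -> w ^+ n = t -> g w = w) ->
  wild_inertia p g.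
Proof.
move=> g_fix L j j_emb [e [pi [y [z [pi_unif y_int z_int yz tE]]]] pe].
case: e pe tE => [|e']; first by rewrite dvdn0.
set e := e'.+1 => pe tE.
have j_alg f : j (fps_alg L f) = iota (fps_laurent f) by apply: j_emb.
have [f [f0 piE]] := eisenstein pi_unif y_int z_int yz tE.
have t0 : t != 0 by rewrite fmorph_eq0 laurentX_neq0.
have [w wE] := root_exists (n := e) isT pe t0.
have w0 : w != 0 by apply: contraNneq t0 => w0; rewrite -wE w0 expr0n.
have [ev [evX ev_subst evE]] := @root_evaluation k e isT _ iota w wE.
have g_ev h : g (ev h) = ev h.
  rewrite evE rmorph_sum; apply: eq_bigr => i _.
  rewrite rmorphM rmorphXn /= absgal_fix; congr (_ ^+ _ * _).
  exact: g_fix wE.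
have [zeta etaE] : exists z, j pi / w = ev z.
  apply: (@eisenstein_series_root ev e _ (fun i => fps_subst e (f i))) => //.
    by rewrite evX.
  rewrite expr_div_n wE -rmorphXn piE rmorphM [j (fps_alg _ _)]j_alg -/t.
  rewrite mulrAC divff // mul1r rmorph_sum; apply: eq_bigr => i _.
  rewrite !rmorphM !rmorphXn /= j_alg evX ev_subst mulrAC; congr (_ * _).
  by rewrite exprMn exprVn mulrCA divff ?mulr1 // expf_neq0.
have g_pi : g (j pi) = j pi.
  have -> : j pi = ev (zeta * fpsX k) by rewrite rmorphM evX -etaE divfK.
  exact: g_ev.
move=> x; have [N xN] := intring_denominator x.
have [h hE] := intring_basis pi_unif y_int z_int yz tE xN.
have gx : g (j (fps_alg L (fpsX k) ^+ N * x)) = j (fps_alg L (fpsX k) ^+ N * x).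
  rewrite hE !rmorph_sum; apply: eq_bigr => i _.
  by rewrite !rmorphM !rmorphXn /= j_alg absgal_fix g_pi.
move: gx; rewrite !rmorphM !rmorphXn /= [j (fps_alg _ _)]j_alg absgal_fix.
by apply: mulfI; rewrite expf_neq0.
Qed.

End WildInertia.

(** * Radical extensions are tame *)

(** The field generated by [z], as an abstract finite extension. *)
Lemma simple_extension (F M : fieldType) (iota : {rmorphism F -> M}) (z : M) :
  algebraicOver iota z ->
  exists (L : fieldExtType F) (j : {rmorphism L -> M}) (u : L),
    [/\ j u = z, forall c, j c%:A = iota c
      & forall x : L, exists q, x = (map_poly (in_alg L) q).[u]].
Proof.
case=> q0 q0_neq0 q0z.
pose Q n := `[< exists q : {poly F}, [/\ q != 0, root (map_poly iota q) z & size q = n] >].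
have exQ : exists n, Q n by exists (size q0); apply/asboolP; exists q0.
case: (ex_minnP exQ) => n /asboolP[q [q_neq0 qz qn]] nmin.
have q_irr : irreducible_poly q.
  apply/(subfx_irreducibleP qz q_neq0) => r rz r_neq0.
  by rewrite qn nmin //; apply/asboolP; exists r.
pose L := SubFieldExtType qz q_irr.
pose j : {rmorphism _ -> _} := @subfx_inj _ _ iota z q.
exists L, j, (subfx_root iota z q); split.
- exact: subfx_inj_root.
- exact: (subfx_inj_base qz).
by move=> x; have [r ->] := subfxEroot qz q_neq0 x; exists r.
Qed.

Section RadicalExtension.
Variables (p : nat) (k : closedFieldType) (L : fieldExtType (laurent k)).
Variables (n : nat) (w : L).
Hypotheses (n_gt0 : (0 < n)%N) (w_root : w ^+ n = (laurentX k)%:A).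
Hypothesis w_gen : forall x : L, exists q, x = (map_poly (in_alg L) q).[w].
Local Notation t := (fps_alg L (fpsX k)).

(** A monic equation of [t^-1] multiplied by a power of [t] would express 1 as a
    multiple of t in k[[t]]. *)
Lemma inv_unif_not_integral : ~ intring t^-1.
Proof.
move=> [F F_mon Ft].
have t0 : t != 0 := fps_alg_unif_neq0 L.
set d := (size F).-1.
have sF : size F = d.+1 by rewrite prednK // size_poly_gt0 monic_neq0.
have F_lead : F`_d = 1 by apply/eqP.
have sum0 : \sum_(i < d.+1) F`_i * fpsX k ^+ (d - i) = 0.
  apply/eqP; rewrite -(fps_alg_eq0 L) rmorph_sum; apply/eqP.
  transitivity (t ^+ d * (map_poly (fps_alg L) F).[t^-1]); last first.
    by rewrite (rootP Ft) mulr0.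
  rewrite (@horner_coef_wide _ d.+1) -?[d.+1]sF ?size_poly // mulr_sumr sF.
  apply: eq_bigr => i _; rewrite rmorphM rmorphXn coef_map /=.
  have leid : (i <= d)%N by rewrite -ltnS.
  have -> : t ^+ d = t ^+ (d - i) * t ^+ i by rewrite -exprD subnK.
  have ti : t ^+ i != 0 by rewrite expf_neq0.
  by rewrite exprVn mulrCA -mulrA divff ?mulr1.
have := congr1 (@fps_const k) sum0.
rewrite big_ord_recr rmorphD [nat_of_ord _]/= subnn mulr1 F_lead rmorph1 rmorph0.
rewrite rmorph_sum big1 ?add0r => [/eqP|i _]; first by rewrite oner_eq0.
by rewrite -(subnSK (ltn_ord i)) exprSr mulrA rmorphM mulrC /fps_const /= mul0r.
Qed.

(** The integers of k((w)) are k[[w]], with uniformizer [w] and [w ^ n = t]. *)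
Lemma radical_tame : ~~ (p %| n)%N -> tamely_ramified L p.
Proof.
move=> pn; exists n => //.
have wE : w ^+ n = t by [].
have t0 : t != 0 := fps_alg_unif_neq0 L.
have w0 : w != 0 by apply: contraNneq t0 => w0; rewrite -wE w0 expr0n gtn_eqF.
have [ev [evX ev_subst evE]] := @root_evaluation k n n_gt0 L (in_alg L) w w_root.
have evX0 : ev (fpsX k) != 0 by rewrite evX.
have value x : laurent_value ev x.
  have value_base c : laurent_value ev c%:A.
    have [f [N fN]] := laurentP c; exists (fps_subst n f), (n * N)%N.
    rewrite ev_subst evX exprM w_root -fN rmorphM rmorphXn mulfK //.
    by rewrite expf_neq0.
  have [q ->] := w_gen x; elim/poly_ind: q => [|q c IH].
    by rewrite rmorph0 horner0 -(rmorph0 ev); apply: laurent_value_series.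
  rewrite rmorphD rmorphM /= map_polyX map_polyC hornerD hornerM hornerX hornerC.
  apply: laurent_valueD => //; last exact: value_base.
  apply: laurent_valueM => //.
  by rewrite -evX; apply: laurent_value_series.
have w_int : intring w.
  exists ('X^n - (fpsX k)%:P); first exact: monicXnsubC.
  rewrite -[map_poly _ _]/(map_poly (fps_alg L) _).
  by rewrite rootE rmorphB /= map_polyXn map_polyC !hornerE wE subrr.
have ev_int h : intring (ev h).
  by rewrite evE; apply: intring_sum => i; apply: intringM (intringX _ w_int) (intring_fps _ _).
have w_nonunit : ~ intring w^-1.
  move=> wV_int; apply: inv_unif_not_integral.
  by rewrite -wE -exprVn; apply: intringX.
have int_ev x : intring x -> exists h, x = ev h.
  have [h [N ->]] := value x; rewrite evX.
  have [-> | h0] := eqVneq h 0; first by exists 0; rewrite rmorph0 mul0r.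
  have [m [g [-> g0]]] := fps_factor h0; have [g' g'g] := fps_invertible g0.
  rewrite rmorphM rmorphXn evX; have [leNm _ | ltmN] := leqP N m.
    exists (fpsX k ^+ (m - N) * g); rewrite rmorphM rmorphXn evX -{1}(subnK leNm) exprD.
    by rewrite mulrAC mulfK ?expf_neq0 // mulrC.
  move=> x_int; case: w_nonunit.
  suff -> : w^-1 = w ^+ m * ev g / w ^+ N * ev g' * w ^+ (N - m.+1).
    by do !apply: intringM => //; apply: intringX.
  have evg : ev g * ev g' = 1 by rewrite mulrC -rmorphM g'g rmorph1.
  have -> : w ^+ N = w ^+ m * w * w ^+ (N - m.+1) by rewrite -exprSr -exprD subnKC.
  have wm : w ^+ m != 0 by rewrite expf_neq0.
  have wN : w ^+ (N - m.+1) != 0 by rewrite expf_neq0.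
  transitivity (ev g * ev g' * w^-1); first by rewrite evg mul1r.
  by field; rewrite w0 wm wN.
have w_unif : uniformizer w.
  split; first split=> //.
    case=> y y_int wy; apply: w_nonunit; suff -> : w^-1 = y by [].
    by apply: (mulfI w0); rewrite wy divff.
  move=> x [/int_ev[h ->] nunit]; exists (ev (fps_shift 1 h)) => //.
  have h0 : fps_const h = 0.
    apply/eqP; apply: contraT => /fps_invertible[g gh]; case: nunit.
    by exists (ev g) => //; rewrite mulrC -rmorphM gh rmorph1.
  by rewrite {1}(fps_const_shift h) h0 rmorph0 add0r rmorphM evX.
exists w, 1, 1; split; rewrite ?mulr1 //; exact: intring1.
Qed.

End RadicalExtension.

Section WildInertiaRoots.
Variables (p : nat) (k : closedFieldType).
Hypotheses (p_prime : prime p) (p_char : p \in [pchar k]).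
Variables (Ksep : fieldType) (iota : {rmorphism laurent k -> Ksep}).

Lemma wild_fixes_roots (g : absgal iota) n w : wild_inertia p g ->
  (0 < n)%N -> ~~ (p %| n)%N -> w ^+ n = iota (laurentX k) -> g w = w.
Proof.
move=> g_wild n_gt0 pn wn.
have [|L [j [u [ju j_emb u_gen]]]] := @simple_extension _ _ iota w.
  exists ('X^n - (laurentX k)%:P); first by rewrite monic_neq0 // monicXnsubC.
  by rewrite rootE rmorphB /= map_polyXn map_polyC !hornerE wn subrr.
rewrite -ju; apply: (g_wild L j) => //; apply: (@radical_tame p k L n u) => //.
by apply: (fmorph_inj j); rewrite rmorphXn ju wn j_emb.
Qed.

End WildInertiaRoots.

(** * The maximal tame extension *)

Section TameElements.
Variables (p : nat) (k : closedFieldType).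
Hypotheses (p_prime : prime p) (p_char : p \in [pchar k]).
Variables (Ksep : fieldType) (iota : {rmorphism laurent k -> Ksep}).
Hypothesis Ksep_closure : separable_closure iota.
Local Notation t := (iota (laurentX k)).
Local Notation cst c := (iota (laurentC c)).
Implicit Types (g h : absgal iota) (x y z w : Ksep) (n m : nat).

Lemma fps_substC n (c : k) : (0 < n)%N -> fps_subst n (fpsC c) = fpsC c.
Proof.
move=> n_gt0; apply/fpsP => -[|i] /=; first by rewrite dvdn0 div0n.
by case: ifP => // /dvdnP[[|q] iE]; rewrite ?iE ?mulnK.
Qed.

Lemma t_neq0 : t != 0. Proof. by rewrite fmorph_eq0 laurentX_neq0. Qed.

Lemma root_neq0 n w : (0 < n)%N -> w ^+ n = t -> w != 0.
Proof.
move=> n_gt0 wn; apply: contraNneq t_neq0 => w0.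
by rewrite -wn w0 expr0n gtn_eqF.
Qed.

Lemma unity_root_const n x : (0 < n)%N -> x ^+ n = 1 ->
  exists c, c ^+ n = 1 /\ x = cst c.
Proof.
move=> n_gt0 xn; have [s sE] := closed_field_poly_normal ('X^n - 1%:P : {poly k}).
rewrite (monicP (monicXnsubC _ n_gt0)) scale1r in sE.
have : root (map_poly (iota \o @laurentC k) ('X^n - 1%:P)) x.
  by rewrite rmorphB /= map_polyXn map_polyC /= !rmorph1 rootE !hornerE xn subrr.
rewrite sE rmorph_prod rootE horner_prod prodf_seq_eq0 => /hasP[c cs /=].
rewrite rmorphB /= map_polyX map_polyC !hornerE subr_eq0 => /eqP ->.
exists c; split=> //; apply/eqP; rewrite -subr_eq0.
have : root ('X^n - 1%:P) c by rewrite sE root_prod_XsubC.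
by rewrite rootE !hornerE.
Qed.

(** Membership in k((w)), where [w ^ n = t]. *)
Definition tame_value n w x :=
  exists (f : fps k) N, x = root_eval n iota w f / w ^+ N.

Lemma tame_valueP n w (ev : {rmorphism fps k -> Ksep}) x :
  ev (fpsX k) = w -> (forall f, ev f = root_eval n iota w f) ->
  tame_value n w x <-> laurent_value ev x.
Proof.
move=> evX evE; split=> -[h [N ->]]; exists h, N; first by rewrite -evE evX.
by rewrite evX evE.
Qed.

(** The field k((w)) is contained in k((W)) when [w] is a constant times a power of
    [W]. The constant is needed to compare two roots of t of different degrees,
    which are only powers of a common root up to a root of unity. *)
Lemma tame_value_refine n m w W (c : k) x : (0 < n)%N -> (0 < m)%N ->
  c != 0 -> W ^+ (n * m) = t -> w = cst c * W ^+ m ->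
  tame_value n w x -> tame_value (n * m) W x.
Proof.
move=> n_gt0 m_gt0 c0 Wt wE [h [N ->]].
have nm_gt0 : (0 < n * m)%N by rewrite muln_gt0 n_gt0.
have [ev [evX ev_subst evE]] := root_evaluation nm_gt0 Wt.
apply/(tame_valueP _ evX evE).
have evC a : ev (fpsC a) = cst a by rewrite -(fps_substC a nm_gt0) ev_subst.
exists (fpsC (c ^- N) *
  \sum_(j < n) (fpsC c * fpsX k ^+ m) ^+ j * fps_subst (n * m) (fps_section n j h)).
exists (m * N)%N; rewrite rmorphM evC evX rmorph_sum.
have -> : root_eval n iota w h =
    \sum_(j < n) ev ((fpsC c * fpsX k ^+ m) ^+ j * fps_subst (n * m) (fps_section n j h)).
  apply: eq_bigr => j _; rewrite rmorphM rmorphXn rmorphM rmorphXn evC evX ev_subst.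
  by rewrite wE.
have -> : cst (c ^- N) = cst c ^- N by rewrite !fmorphV !rmorphXn.
by rewrite wE exprMn -exprM invfM; ring.
Qed.

Lemma root_refine n n' w w' : (0 < n)%N -> (0 < n')%N -> ~~ (p %| n')%N ->
  w ^+ n = t -> w' ^+ n' = t ->
  exists W c, [/\ W ^+ n' = w, W ^+ (n * n') = t, c != 0 & w' = cst c * W ^+ n].
Proof.
move=> n_gt0 n'_gt0 pn' wn wn'.
have w0 := root_neq0 n_gt0 wn.
have [W Ww] := root_exists p_char Ksep_closure n'_gt0 pn' w0.
have Wt : W ^+ (n * n') = t by rewrite mulnC exprM Ww.
have Wn0 : W ^+ n != 0.
  by rewrite expf_neq0 // (root_neq0 _ Wt) // muln_gt0 n_gt0.
have [|c [cn' cE]] := @unity_root_const n' (w' / W ^+ n) n'_gt0.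
  by rewrite expr_div_n -exprM Wt wn' divff // t_neq0.
exists W, c; split=> //; last by rewrite -cE divfK.
by apply: contraTneq (oner_neq0 k) => c0; rewrite -cn' c0 expr0n gtn_eqF // eqxx.
Qed.

(** The maximal tamely ramified extension is the union of the k((w)), [w] running
    over the roots of t of degree prime to [p]. *)
Definition tame x := exists n w,
  [/\ (0 < n)%N, ~~ (p %| n)%N, w ^+ n = t & tame_value n w x].

Lemma tame_common n w x y : (0 < n)%N -> ~~ (p %| n)%N -> w ^+ n = t ->
  tame_value n w x -> tame y ->
  exists m W, [/\ (0 < m)%N, ~~ (p %| m)%N, W ^+ m = w,
    tame_value (n * m) W x & tame_value (n * m) W y].
Proof.
move=> n_gt0 pn wn xw [m [w' [m_gt0 pm wm yw']]].
have [W [c [Ww Wt c0 w'E]]] := root_refine n_gt0 m_gt0 pm wn wm.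
exists m, W; split=> //.
  apply: (tame_value_refine n_gt0 m_gt0 (oner_neq0 k) Wt _ xw).
  by rewrite !rmorph1 mul1r.
rewrite mulnC; apply: (tame_value_refine m_gt0 n_gt0 c0 _ w'E yw').
by rewrite mulnC.
Qed.

Lemma tame_op (op : Ksep -> Ksep -> Ksep) :
  (forall ev : {rmorphism fps k -> Ksep}, ev (fpsX k) != 0 -> forall x y,
     laurent_value ev x -> laurent_value ev y -> laurent_value ev (op x y)) ->
  forall x y, tame x -> tame y -> tame (op x y).
Proof.
move=> opP x y [n [w [n_gt0 pn wn xw]]] y_tame.
have [m [W [m_gt0 pm Ww xW yW]]] := tame_common n_gt0 pn wn xw y_tame.
have Wt : W ^+ (n * m) = t by rewrite mulnC exprM Ww.
have nm_gt0 : (0 < n * m)%N by rewrite muln_gt0 n_gt0.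
exists (n * m)%N, W; split=> //; first by rewrite Euclid_dvdM // negb_or pn.
have [ev [evX ev_subst evE]] := root_evaluation nm_gt0 Wt.
have /opP ev_op : ev (fpsX k) != 0 by rewrite evX (root_neq0 nm_gt0 Wt).
by apply/(tame_valueP _ evX evE); apply: ev_op; apply/(tame_valueP _ evX evE).
Qed.

Lemma tameM x y : tame x -> tame y -> tame (x * y).
Proof. by apply: (tame_op (op := *%R)) => ev _; apply: laurent_valueM. Qed.

Lemma tameB x y : tame x -> tame y -> tame (x - y).
Proof.
apply: (tame_op (op := fun x y => x - y)) => ev ev0 {}x {}y xv yv; apply: laurent_valueD => //.
by rewrite -mulN1r -(rmorph1 ev) -rmorphN; apply: laurent_valueM => //; apply: laurent_value_series.
Qed.

Lemma tame_base c : tame (iota c).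
Proof.
have [f [N fN]] := laurentP c.
have one_gt0 : (0 < 1)%N by [].
have [ev [evX ev_subst evE]] := root_evaluation one_gt0 (erefl : t ^+ 1 = t).
exists 1, t; split=> //; first by rewrite dvdn1 gtn_eqF // prime_gt1.
apply/(tame_valueP _ evX evE); exists (fps_subst 1 f), N.
by rewrite ev_subst evX -fN rmorphM rmorphXn mulfK // expf_neq0 // t_neq0.
Qed.

Lemma tame_root n w : (0 < n)%N -> ~~ (p %| n)%N -> w ^+ n = t -> tame w.
Proof.
move=> n_gt0 pn wn; exists n, w; split=> //.
have [ev [evX ev_subst evE]] := root_evaluation n_gt0 wn.
by apply/(tame_valueP _ evX evE); rewrite -evX; apply: laurent_value_series.
Qed.

(** The Galois correspondence for the maximal tame extension: an automorphism fixing
    it fixes the roots of t, so lies in the wild inertia. *)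
Lemma wild_invariants_tame x : (forall g, wild_inertia p g -> g x = x) -> tame x.
Proof.
move=> x_fix; apply: (fixed_by_stabilizer Ksep_closure (S := tame)).
- exact: tame_base.
- exact: tameB.
- exact: tameM.
move=> g g_fix; apply: x_fix; apply: (tame_roots_fixed p_char Ksep_closure).
by move=> n w n_gt0 pn wn; apply: g_fix; apply: tame_root wn.
Qed.

Lemma tame_wild_fixed x g : tame x -> wild_inertia p g -> g x = x.
Proof.
move=> [n [w [n_gt0 pn wn [h [N ->]]]]] g_wild.
have gw : g w = w := wild_fixes_roots g_wild n_gt0 pn wn.
rewrite rmorphM fmorphV rmorphXn /= gw; congr (_ / _).
rewrite rmorph_sum; apply: eq_bigr => j _.
by rewrite rmorphM rmorphXn /= gw absgal_fix.
Qed.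

Lemma wild_group1 : wild_inertia p (1%g : absgal iota).
Proof. by []. Qed.

Lemma wild_groupM g h : wild_inertia p g -> wild_inertia p h -> wild_inertia p (g * h)%g.
Proof.
by move=> gP hP L j jE L_tame x; rewrite absgalM (hP L j jE L_tame) (gP L j jE L_tame).
Qed.

Lemma wild_groupV g : wild_inertia p g -> wild_inertia p g^-1%g.
Proof. by move=> gP L j jE L_tame x; apply: absgalV_fix; apply: gP. Qed.

(** Conjugation permutes the embeddings of a given tame extension. *)
Lemma wild_normal g h : wild_inertia p g -> wild_inertia p (h^-1 * g * h)%g.
Proof.
move=> gP L j jE L_tame x; rewrite -mulgA !absgalM.
pose hj : {rmorphism L -> Ksep} := h \o j.
have -> : g (h (j x)) = h (j x).
  by apply: (gP L hj) => // c; rewrite /= jE absgal_fix.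
exact: absgalK.
Qed.

Lemma base_infinite (s : seq Ksep) : exists c, iota c \notin s.
Proof.
apply: contrapT => all_s.
pose powers := [seq fps_laurent (fpsX k ^+ i) | i <- seq.iota 0 (size s).+1].
have pow_inj : injective (fun i => fps_laurent (fpsX k ^+ i)).
  move=> i j /eqP; rewrite -subr_eq0 -rmorphB fps_laurent_eq0 => /eqP/fpsP/(_ i).
  rewrite coef_fpsB !coef_fpsXn eqxx; case: eqP => // _ /eqP.
  by rewrite subr0 oner_eq0.
have : uniq (map iota powers).
  by rewrite map_inj_uniq ?map_inj_uniq ?iota_uniq //; apply: fmorph_inj.
move=> /(@uniq_leq_size _ _ s); rewrite !size_map size_iota ltnn => absurd.
suff: false by []; apply: absurd => _ /mapP[c _ ->]; apply: contrapT => /negP cs.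
by apply: all_s; exists c.
Qed.

End TameElements.

(** * The field cut out by a character of the wild inertia *)

Section PrimeField.
Variables (p : nat) (F : fieldType).
Hypotheses (p_prime : prime p) (p_char : p \in [pchar F]).
Implicit Types a b : 'F_p.
Local Notation fp a := ((nat_of_ord a)%:R : F).

Lemma Fp_ltn a : (a < p)%N.
Proof. by rewrite -{2}(Fp_cast p_prime) ltn_ord. Qed.

Lemma natr_FpD a b : fp (a + b)%R = fp a + fp b.
Proof.
rewrite -natrD -[RHS](GRing.natr_mod_pchar p_char) /=; congr (_ %% _)%:R.
exact: Fp_cast.
Qed.

Lemma natr_Fp_inj : injective (fun a => fp a).
Proof.
have ltW a b : (a <= b)%N -> fp a = fp b -> a = b.
  move=> leab /esym/eqP; rewrite -subr_eq0 -natrB // -(dvdn_pcharf p_char).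
  rewrite /dvdn modn_small; last by rewrite (leq_ltn_trans (leq_subr _ _)) // Fp_ltn.
  by rewrite subn_eq0 => leba; apply/val_inj/eqP; rewrite eqn_leq leab.
move=> a b eqab; case/orP: (leq_total a b) => le; first exact: ltW le eqab.
by apply/esym; apply: ltW le (esym eqab).
Qed.

Lemma natr_Fp_pow a : fp a ^+ p = fp a.
Proof. by rewrite -(pFrobenius_autE p_char) pFrobenius_aut_nat. Qed.

(** The equation [X ^ p = X] has no more than [p] roots. *)
Lemma frobenius_fixed (z : F) : z ^+ p = z -> exists a, z = fp a.
Proof.
move=> zp; apply: contrapT => nz.
have p_gt1 := prime_gt1 p_prime.
pose rs := z :: [seq fp a | a : 'F_p].
have sQ : size ('X^p - 'X : {poly F}) = p.+1.
  by rewrite size_polyDl size_polyXn // size_polyN size_polyX ltnS.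
have := @max_poly_roots _ ('X^p - 'X) rs; rewrite sQ /= size_image card_Fp // ltnn.
move=> absurd; suff: false by []; apply: absurd.
- by rewrite -size_poly_eq0 sQ.
- apply/andP; split; first by rewrite rootE !hornerE zp subrr.
  by apply/allP => _ /mapP[a _ ->]; rewrite rootE !hornerE natr_Fp_pow subrr.
rewrite map_inj_uniq ?enum_uniq ?andbT; last exact: natr_Fp_inj.
by apply/negP => /mapP[a _ za]; apply: nz; exists a.
Qed.

End PrimeField.

Lemma expr_gcdn_eq1 (F : fieldType) (z : F) m n :
  z ^+ m = 1 -> z ^+ n = 1 -> z ^+ gcdn m n = 1.
Proof.
have [-> | m_gt0 zm zn] := posnP m; first by rewrite gcd0n.
have [a _ /dvdnP[q qE]] := Bezoutl n m_gt0.
have := congr1 (GRing.exp z) qE; rewrite exprD (mulnC a) (mulnC q) !exprM zm zn.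
by rewrite !expr1n mulr1.
Qed.

Section CharacterField.
Variables (p : nat) (k : closedFieldType).
Hypotheses (p_prime : prime p) (p_char : p \in [pchar k]).
Variables (Ksep : fieldType) (iota : {rmorphism laurent k -> Ksep}).
Hypothesis Ksep_closure : separable_closure iota.
Local Notation t := (iota (laurentX k)).
Local Notation cst c := (iota (laurentC c)).
Local Notation P := (@wild_inertia k Ksep iota p).
Implicit Types (g h : absgal iota) (x y z w : Ksep) (n m : nat).

Lemma eval_at_inv_fixed phi u h : h u = u -> h (eval_at_inv iota phi u) = eval_at_inv iota phi u.
Proof.
move=> hu; rewrite /eval_at_inv -horner_map /= fmorphV /= hu; congr (_.[_]).
rewrite -map_poly_comp_id0 ?rmorph0 //; apply: eq_map_poly => c /=.
exact: absgal_fix.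
Qed.

(** A root of t of higher degree prime to [p] puts [z] and [w] in a common field of
    Laurent series and preserves the condition on the exponents. *)
Lemma as_reduced_rigid n w z phi : (0 < n)%N -> ~~ (p %| n)%N -> w ^+ n = t ->
  tame p iota z -> as_reduced p phi -> eval_at_inv iota phi w = z ^+ p - z -> phi = 0.
Proof.
move=> n_gt0 pn wn z_tame phiR phiE.
have w_tame : tame_value iota n w w.
  have [ev [evX ev_subst evE]] := root_evaluation n_gt0 wn.
  by apply/(tame_valueP _ evX evE); rewrite -evX; apply: laurent_value_series.
have [m [W [m_gt0 pm Ww _ zW]]] :=
  tame_common p_char Ksep_closure n_gt0 pn wn w_tame z_tame.
have Wt : W ^+ (n * m) = t by rewrite mulnC exprM Ww.
have nm_gt0 : (0 < n * m)%N by rewrite muln_gt0 n_gt0.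
have [ev [evX ev_subst evE]] := root_evaluation nm_gt0 Wt.
have ev0 : ev (fpsX k) != 0 by rewrite evX (root_neq0 nm_gt0 Wt).
have evC c : ev (fpsC c) = cst c by rewrite -(fps_substC c nm_gt0) ev_subst.
suff comp0 : phi \Po 'X^m = 0.
  apply/polyP => i; have := coef_comp_poly_Xn phi (i * m) m_gt0.
  by rewrite comp0 !coef0 dvdn_mull // mulnK.
apply: (as_reduction_unique p_prime ev0 (z := z)).
- move=> i; rewrite coef_comp_poly_Xn //; case: ifP => [/dvdnP[q ->]|]; last by rewrite eqxx.
  by rewrite mulnK // Euclid_dvdM // negb_or pm andbT; apply: phiR.
- exact/(tame_valueP _ evX evE).
rewrite -phiE /eval_at_inv evX map_comp_poly map_polyXn horner_comp hornerXn exprVn Ww.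
by congr (_.[_]); apply: eq_map_poly => c /=; rewrite evC.
Qed.

(** By Hilbert 90 the homomorphism is that of an Artin-Schreier generator [y] of an
    extension of the maximal tame one; [y] is then changed by a tame element in
    order to reduce [y ^ p - y]. *)
Lemma artin_schreier_generator (a : absgal iota -> 'F_p) (s : seq Ksep) :
  (forall g h, P g -> P h -> a (g * h)%g = a g + a h) ->
  (forall g, P g -> (forall y, y \in s -> g y = y) -> a g = 0) ->
  exists n w (phi : {poly k}) y, [/\ [/\ (0 < n)%N, ~~ (p %| n)%N & w ^+ n = t], as_reduced p phi,
    y ^+ p - y = eval_at_inv iota phi w & forall g, P g -> g y - y = (a g : nat)%:R].
Proof.
move=> aM a_s; have KC := Ksep_char p_char iota.
have [|||||y yP] := @hilbert90 _ _ iota Ksep_closure (base_infinite iota) P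
  _ _ _ (fun g => (a g : nat)%:R) s.
- exact: wild_group1.
- exact: wild_groupM.
- exact: wild_groupV.
- by move=> g h Pg Ph; rewrite aM // natr_FpD // rmorph_nat.
- by move=> g Pg gs; rewrite a_s.
have c_fix g : P g -> g (y ^+ p - y) = y ^+ p - y.
  move=> Pg; have gy : g y = y + (a g : nat)%:R by rewrite -yP // addrC subrK.
  rewrite rmorphB rmorphXn /= gy -(pFrobenius_autE KC) rmorphD /= !pFrobenius_autE.
  rewrite natr_Fp_pow //; ring.
have [n [w [n_gt0 pn wn c_tame]]] := wild_invariants_tame p_prime p_char Ksep_closure c_fix.
have [ev [evX ev_subst evE]] := root_evaluation n_gt0 wn.
have ev0 : ev (fpsX k) != 0 by rewrite evX (root_neq0 n_gt0 wn).
have evC c : ev (fpsC c) = cst c by rewrite -(fps_substC c n_gt0) ev_subst.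
have /(tame_valueP _ evX evE)[f [N cE]] := c_tame.
have [z [phi [zv phiR zE]]] := as_reduction p_prime p_char ev0 f N.
have z_tame : tame p iota z.
  by exists n, w; split=> //; apply/(tame_valueP _ evX evE).
exists n, w, phi, (y - z); split=> //; last first.
  by move=> g Pg; rewrite rmorphB /= (tame_wild_fixed z_tame Pg) -yP //; ring.
rewrite -(pFrobenius_autE KC) rmorphB /= !pFrobenius_autE.
have -> : y ^+ p - z ^+ p - (y - z) = y ^+ p - y - (z ^+ p - z) by ring.
rewrite cE zE addrC addKr /eval_at_inv evX; congr (_.[_]).
by apply: eq_map_poly => c /=; rewrite evC.
Qed.

(** Let c be the reduced polynomial [y ^ p - y] in [w^-1]. If [h] preserves the
    homomorphism then [h y - y] is tame, so [h c - c], which is reduced, is of the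
    form [z ^ p - z] with z tame, hence 0. Thus [h] multiplies [w] by a root of
    unity whose order divides [n] and the exponents of c. So [h] fixes [u = w ^ d], where
    [d] is the gcd of [n] and these exponents, and c is a polynomial in [u^-1]. *)
Lemma character_field (a : absgal iota -> 'F_p) (s : seq Ksep) :
  (forall g h, P g -> P h -> a (g * h)%g = a g + a h) ->
  (forall g, P g -> (forall y, y \in s -> g y = y) -> a g = 0) ->
  exists r u (phi : {poly k}) y, [/\ (0 < r)%N /\ coprime r p, u ^+ r = t, phi`_0 = 0,
    y ^+ p - y = eval_at_inv iota phi u
    & (forall g, P g -> g y - y = (a g : nat)%:R) /\
      (forall h, (forall g, P g -> a (h^-1 * g * h)%g = a g) -> h u = u)].
Proof.
move=> aM a_s.
have [n [w [phi [y [[n_gt0 pn wn] phiR yE ya]]]]] := artin_schreier_generator aM a_s.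
pose d := \big[gcdn/n]_(i < size phi | phi`_i != 0) i.
have dn : (d %| n)%N.
  rewrite /d; elim/big_rec: _ => // i x _; exact: dvdn_trans (dvdn_gcdr _ _).
have d_gt0 : (0 < d)%N := dvdn_gt0 n_gt0 dn.
have di i : phi`_i != 0 -> (d %| i)%N.
  move=> phi_i; have lti : (i < size phi)%N.
    by rewrite ltnNge; apply: contra phi_i => /(nth_default 0)->.
  rewrite /d (bigD1 (Ordinal lti)) //=; exact: dvdn_gcdl.
pose phi' := \poly_(j < size phi) phi`_(j * d).
have phiE : phi = phi' \Po 'X^d.
  apply/polyP => i; rewrite coef_comp_poly_Xn //; case: ifP => [id|nid]; last first.
    by apply/eqP; apply: contraFT nid => /di.
  rewrite coef_poly divnK //; case: ltnP => // lei.
  by rewrite nth_default // (leq_trans lei) // leq_div.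
have eval_u : eval_at_inv iota phi w = eval_at_inv iota phi' (w ^+ d).
  rewrite /eval_at_inv {1}phiE (map_comp_poly (iota \o @laurentC k)).
  by rewrite map_polyXn horner_comp hornerXn exprVn.
exists (n %/ d)%N, (w ^+ d), phi', y; split=> //.
- split; first by rewrite divn_gt0 // dvdn_leq.
  rewrite coprime_sym prime_coprime //; apply: contra pn => /dvdn_trans; apply.
  by apply: dvdn_div.
- by rewrite -exprM mulnC divnK.
- rewrite coef_poly; case: ifP => // _; apply/eqP; apply: contraT => /phiR.
  by rewrite mul0n dvdn0.
- by rewrite yE.
split=> // h h_stab.
have w0 : w != 0 := root_neq0 n_gt0 wn.
have [c [cn hwE]] : exists c, c ^+ n = 1 /\ h w / w = cst c.
  apply: unity_root_const => //.
  by rewrite expr_div_n wn -rmorphXn wn /= absgal_fix divff // t_neq0.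
have hw : h w = cst c * w by rewrite -hwE divfK.
have c0 : c != 0.
  by apply: contraTneq (oner_neq0 k) => c0; rewrite -cn c0 expr0n gtn_eqF // eqxx.
have z_tame : tame p iota (h y - y).
  apply: (wild_invariants_tame p_prime p_char Ksep_closure) => g Pg.
  rewrite rmorphB /=.
  have gy g' : P g' -> g' y = y + (a g' : nat)%:R by move=> Pg'; rewrite -ya // addrC subrK.
  have -> : g (h y) = h ((h^-1 * g * h)%g y) by rewrite -!absgalM mulgA mulgA mulgV mul1g.
  rewrite (gy g) // gy; last exact: wild_normal.
  by rewrite h_stab // rmorphD rmorph_nat /=; ring.
pose phi1 := \poly_(i < size phi) (phi`_i * (c ^- i - 1)).
have phi1_0 : phi1 = 0.
  apply: (as_reduced_rigid n_gt0 pn wn z_tame).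
    move=> i; rewrite coef_poly; case: ifP; rewrite ?eqxx // => _.
    by rewrite mulf_eq0 negb_or => /andP[/phiR].
  have KC := Ksep_char p_char iota.
  rewrite -(pFrobenius_autE KC) rmorphB /= !pFrobenius_autE.
  have -> : h y ^+ p - y ^+ p - (h y - y) = h (y ^+ p - y) - (y ^+ p - y).
    by rewrite rmorphB rmorphXn /=; ring.
  rewrite yE /eval_at_inv -horner_map /= fmorphV /= hw.
  rewrite (@horner_coef_wide _ (size phi)); last first.
    by rewrite (leq_trans (size_poly _ _)) // size_poly.
  rewrite (@horner_coef_wide _ (size phi)); last first.
    by rewrite (leq_trans (size_poly _ _)) // size_poly.
  rewrite (@horner_coef_wide _ (size phi)) ?size_poly //.
  rewrite -sumrB; apply: eq_bigr => i _.
  rewrite !(coef_map (iota \o @laurentC k)) [in RHS]coef_map /= !(coef_map (iota \o @laurentC k)) /=.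
  rewrite absgal_fix coef_poly ltn_ord !rmorphM rmorphB rmorph1 /= !fmorphV !rmorphXn.
  by rewrite invfM exprMn !exprVn rmorphB rmorph1 fmorphV rmorphXn /=; ring.
have ci i : phi`_i != 0 -> c ^+ i = 1.
  move=> phi_i; have lti : (i < size phi)%N.
    by rewrite ltnNge; apply: contra phi_i => /(nth_default 0)->.
  have /eqP := congr1 (fun q : {poly k} => q`_i) phi1_0.
  rewrite coef_poly lti coef0 mulf_eq0 (negPf phi_i) /= subr_eq0 => /eqP ci.
  by rewrite -[c ^+ i]invrK ci invr1.
have cd : c ^+ d = 1.
  rewrite /d; elim/big_rec: _ => // i m phi_i cm.
  by apply: expr_gcdn_eq1 => //; apply: ci.
by rewrite rmorphXn /= hw exprMn -!rmorphXn cd !rmorph1 mul1r.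
Qed.

End CharacterField.

(** * Simultaneous eigenbases *)

Section Eigenbasis.
Variables (E : fieldType) (V : vectType E).

(** A free sequence of elements of [S] of maximal length. *)
Lemma spanning_seq (U : vectType E) (S : U -> Prop) : exists X : seq U,
  [/\ forall x, x \in X -> S x, free X & forall x, S x -> x \in <<X>>%VS].
Proof.
pose Q n := `[< exists X : seq U, [/\ forall x, x \in X -> S x, free X & size X = n] >].
have exQ : exists n, Q n by exists 0; apply/asboolP; exists [::]; split=> //; apply: nil_free.
have Q_le n : Q n -> (n <= \dim {:U})%N.
  case/asboolP=> X [_ freeX <-]; rewrite -(eqP freeX).
  exact: dimvS (subvf _).
case: (ex_maxnP exQ Q_le) => n /asboolP[X [XS freeX sX]] nmax.
exists X; split=> // x Sx; apply: contraT => xX.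
have : Q n.+1.
  apply/asboolP; exists (x :: X); split; last by rewrite /= sX.
    by move=> y; rewrite inE => /predU1P[-> | /XS].
  by rewrite free_cons xX.
by move/nmax; rewrite ltnn.
Qed.

Variables (T : Type) (P : T -> Prop) (rho : T -> 'End(V)) (p : nat).
Hypothesis p_prime : prime p.
Hypothesis p_neq0 : p%:R != 0 :> E.
Variable z : E.
Hypothesis z_prim : p.-primitive_root z.
Hypothesis rho_comm : forall g h, P g -> P h -> forall x, rho g (rho h x) = rho h (rho g x).
Hypothesis rho_pow : forall g x, P g -> iter p (rho g) x = x.

Definition eigen (f : 'End(V)) (x : V) := exists c : E, f x = c *: x.

(** The components of [x] are its images under the spectral projectors, which are
    polynomials in [rho g] and so preserve the eigenspaces of the operators that
    commute with it. *)
Lemma eigen_sum g x : P g -> exists y : 'I_p -> V,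
  [/\ x = \sum_i y i, forall i, eigen (rho g) (y i)
    & forall i (f : 'End(V)), (forall y, f (rho g y) = rho g (f y)) -> eigen f x -> eigen f (y i)].
Proof.
move=> Pg; have p_gt0 := prime_gt0 p_prime.
have zp : z ^+ p = 1 := prim_expr_order z_prim.
have z0 : z != 0 by apply: contraTneq (oner_neq0 E) => z0; rewrite -zp z0 expr0n gtn_eqF ?eqxx.
pose y (i : 'I_p) := p%:R^-1 *: \sum_(j < p) z ^- (i * j) *: iter j (rho g) x.
exists y; split.
- rewrite -scaler_sumr exchange_big /=.
  rewrite (bigD1 (Ordinal p_gt0)) //= [X in _ + X]big1 ?addr0 => [|j j0].
    under eq_bigr do rewrite muln0 expr0 invr1 scale1r.
    by rewrite sumr_const card_ord -scaler_nat scalerA mulVf // scale1r.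
  rewrite -scaler_suml; suff -> : \sum_(i < p) z ^- (i * j) = 0 by rewrite scale0r.
  have zj : z ^- j != 1.
    rewrite invr_eq1 -(prim_order_dvd z_prim) gtnNdvd //.
    by rewrite lt0n; apply: contraNneq j0 => j0; apply/eqP/val_inj.
  have : (z ^- j - 1) * \sum_(i < p) (z ^- j) ^+ i = 0.
    by rewrite -subrX1 exprVn -exprM mulnC exprM zp expr1n invr1 subrr.
  move/eqP; rewrite mulf_eq0 subr_eq0 (negPf zj) /= => /eqP sum0.
  by rewrite -[RHS]sum0; apply: eq_bigr => i _; rewrite exprVn -exprM mulnC.
- move=> i; exists (z ^+ i); rewrite /y linearZ linear_sum /= scalerA mulrC -scalerA.
  congr (_ *: _); rewrite scaler_sumr.
  case: (p) p_gt0 zp (rho_pow x Pg) @y i => // q _ zp rho_q _ i.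
  rewrite big_ord_recr big_ord_recl /= addrC; congr (_ + _).
    rewrite linearZ /= -iterS rho_q scalerA muln0 expr0 invr1 mulr1; congr (_ *: _).
    have /(congr1 (fun a => a ^+ i)) := zp; rewrite expr1n -exprM => zqi.
    apply: (mulIf (x := z ^+ (i * q))); first by rewrite expf_neq0.
    by rewrite mulVf ?expf_neq0 // -exprD -mulnS mulnC.
  apply: eq_bigr => j _; rewrite linearZ /= scalerA; congr (_ *: _).
  rewrite /bump add1n mulnSr exprD invfM mulrCA divff ?mulr1 // expf_neq0 //.
move=> i f fcomm [c fx]; exists c; rewrite /y linearZ linear_sum /= scalerA mulrC -scalerA.
congr (_ *: _); rewrite scaler_sumr; apply: eq_bigr => j _.
rewrite linearZ /= [RHS]scalerA mulrC -scalerA; congr (_ *: _).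
by elim: (j : nat) => //= n IH; rewrite fcomm IH linearZ.
Qed.

(** It is enough to diagonalize the finitely many operators of a spanning sequence
    of the span of all of them, which is done one operator at a time. *)
Lemma eigenbasis : exists (n : nat) (b : n.-tuple V) (chi : 'I_n -> T -> E),
  [/\ free b, forall x, x \in <<b>>%VS
    & forall (i : 'I_n) g, P g -> rho g b`_i = chi i g *: b`_i].
Proof.
have [F [FP _ F_span]] := @spanning_seq _ (fun f => exists2 g, P g & f = rho g).
have sumF (s : seq 'End(V)) : {subset s <= F} -> forall x, exists r : seq V,
    x = \sum_(y <- r) y /\ forall y, y \in r -> forall f, f \in s -> eigen f y.
  elim: s => [|f s IH] sF x; first by exists [:: x]; rewrite big_seq1.
  have [|r [-> rP]] := IH _ x; first by move=> h hs; apply: sF; rewrite inE hs orbT.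
  have [g Pg fE] := FP f (sF _ (mem_head _ _)).
  elim: r rP => [|y r IHr] rP; first by exists [::]; rewrite !big_nil.
  have [|r' [rE r'P]] := IHr; first by move=> w wr; apply: rP; rewrite inE wr orbT.
  have [Y [yE Yg Yf]] := eigen_sum y Pg.
  exists (codom Y ++ r'); rewrite big_cons big_cat /= rE; split.
    by rewrite {1}yE big_image.
  move=> w; rewrite mem_cat => /orP[/codomP[i ->] | /r'P //] h.
  rewrite inE => /predU1P[-> | hs]; first by rewrite fE; apply: Yg.
  apply: Yf; last by apply: rP => //; apply: mem_head.
  have [g' Pg' ->] : exists2 g', P g' & h = rho g' by apply: FP; apply: sF; rewrite inE hs orbT.
  by move=> w'; apply: rho_comm.
have [X [XS freeX X_span]] := @spanning_seq V (fun x => forall g, P g -> eigen (rho g) x).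
exists (size X), (in_tuple X).
have [chi chiP] : {chi : 'I_(size X) -> T -> E & forall (i : 'I_(size X)) g, P g -> rho g X`_i = chi i g *: X`_i}.
  apply: (choice (P := fun (i : 'I_(size X)) (c : T -> E) => forall g, P g -> rho g X`_i = c g *: X`_i)) => i.
  have Xi : X`_i \in X by apply: mem_nth.
  have [c cP] : {c : T -> E & forall g, P g -> rho g X`_i = c g *: X`_i}.
    apply: (choice (P := fun g c => P g -> rho g X`_i = c *: X`_i)) => g.
    have [Pg | nPg] := pselect (P g); last by exists 0.
    by have [c cE] := XS _ Xi g Pg; exists c.
  by exists c.
exists chi; split=> // x.
have [r [-> rP]] := sumF F (fun f fF => fF) x.
rewrite big_seq; apply: memv_suml => y yr; apply: X_span => g Pg.
have : rho g \in <<F>>%VS by apply: F_span; exists g.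
move/(coord_span (X := in_tuple F)) => ->; rewrite /eigen sum_lfunE.
have eigF (i : 'I_(size F)) : exists c, F`_i y = c *: y.
  by apply: rP => //; apply: mem_nth.
have [c cP] := choice eigF.
exists (\sum_i coord (in_tuple F) i (rho g) * c i); rewrite scaler_suml.
by apply: eq_bigr => i _; rewrite scale_lfunE cP scalerA.
Qed.

End Eigenbasis.

(** * Clifford theory *)

Section Clifford.
Variables (K L : fieldType) (iota : K -> L).
Local Notation G := (absgal iota).
Variables (E : fieldType) (V : vectType E) (rho : G -> 'End(V)) (P : G -> Prop).
Hypothesis rho1 : rho 1%g = \1%VF.
Hypothesis rhoM : forall g h, rho (g * h)%g = (rho g \o rho h)%VF.
Hypothesis P_normal : forall g h, P g -> P (h^-1 * g * h)%g.
Hypothesis rho_indec : indecomposable rho.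
Variables (n : nat) (b : n.-tuple V) (chi : 'I_n -> G -> E).
Hypothesis b_free : free b.
Hypothesis b_span : forall x, x \in <<b>>%VS.
Hypothesis chiP : forall (i : 'I_n) g, P g -> rho g b`_i = chi i g *: b`_i.
Implicit Types (g h : G) (x y : V) (i j : 'I_n) (c : G -> E) (A : pred 'I_n).

Lemma rhoE g h x : rho (g * h)%g x = rho g (rho h x).
Proof. by rewrite rhoM lfunE. Qed.

Lemma rhoVK g x : rho g (rho g^-1%g x) = x.
Proof. by rewrite -rhoE mulgV rho1 lfunE. Qed.

(** The values of a character outside [P] have no meaning, so characters are
    compared on [P]. *)
Definition agree c c' := forall g, P g -> c g = c' g.
Definition conj_char h c : G -> E := fun g => c (h^-1 * g * h)%g.
Definition isotypic c x := forall g, P g -> rho g x = c g *: x.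

Lemma isotypic_agree c c' x : agree c c' -> isotypic c x -> isotypic c' x.
Proof. by move=> cc' cx g Pg; rewrite -cc' // cx. Qed.

Lemma isotypic_conj c h x : isotypic c x -> isotypic (conj_char h c) (rho h x).
Proof.
move=> cx g Pg; rewrite -rhoE.
have -> : (g * h = h * (h^-1 * g * h))%g by rewrite !mulgA mulgV mul1g.
by rewrite rhoE cx ?linearZ //; apply: P_normal.
Qed.

Lemma conj_agree h c c' : agree c c' -> agree (conj_char h c) (conj_char h c').
Proof. by move=> cc' g Pg; apply: cc'; apply: P_normal. Qed.

Lemma conj_charM g h c : conj_char g (conj_char h c) = conj_char (g * h)%g c.
Proof. by apply/funext => x; rewrite /conj_char invgM !mulgA. Qed.

Lemma conj_char1 c : conj_char 1%g c = c.
Proof. by apply/funext => x; rewrite /conj_char invg1 mul1g mulg1. Qed.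

Lemma isotypic_basis i : isotypic (chi i) b`_i.
Proof. by move=> g Pg; apply: chiP. Qed.

Lemma coord_sum x : x = \sum_i coord b i x *: b`_i.
Proof. exact: coord_span. Qed.

Lemma isotypic_coord c x i : isotypic c x -> coord b i x != 0 -> agree (chi i) c.
Proof.
move=> cx xi0 g Pg; apply: (mulIf xi0).
have /(congr1 (coord b i)) := cx g Pg; rewrite linearZ /= => <-.
rewrite [in RHS](coord_sum x) linear_sum linear_sum /=.
under eq_bigr => j _ do rewrite linearZ /= chiP // scalerA linearZ /= coord_free //.
by rewrite (bigD1 i) //= eqxx mulr1 big1 ?addr0 1?mulrC // => j /negPf->; rewrite mulr0.
Qed.

(** The projection on the span of the basis vectors with index in [A], along the
    span of the others. *)
Definition part A x : V := \sum_(i | A i) coord b i x *: b`_i.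

Lemma part_linear A : linear (part A).
Proof.
move=> a x y; rewrite /part scaler_sumr -big_split; apply: eq_bigr => i _ /=.
by rewrite linearP scalerDl scalerA.
Qed.

Definition partL A : 'End(V) := linfun (HB.pack_for {linear V -> V} (part A)
  (GRing.isLinear.Build E V V *:%R (part A) (part_linear A))).

Lemma partE A x : partL A x = part A x.
Proof. by rewrite lfunE. Qed.

Lemma coord_part A i x : A i -> coord b i (partL A x) = coord b i x.
Proof.
move=> Ai; rewrite partE /part linear_sum (bigD1 i) //= linearZ /= coord_free //.
rewrite eqxx mulr1 big1 ?addr0 // => j /andP[_ ji].
by rewrite linearZ /= coord_free // (negPf ji) mulr0.
Qed.

Lemma part_isotypic A c x : isotypic c x ->
  (forall i, agree (chi i) c -> A i) -> partL A x = x.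
Proof.
move=> cx cA; rewrite partE [in RHS](coord_sum x) /part [in RHS](bigID A) /=.
rewrite [X in _ = _ + X]big1 ?addr0 // => i nAi.
have [-> | xi0] := eqVneq (coord b i x) 0; first by rewrite scale0r.
by rewrite (cA i (isotypic_coord cx xi0)) in nAi.
Qed.

Lemma part_isotypic0 A c x : isotypic c x ->
  (forall i, A i -> ~ agree (chi i) c) -> partL A x = 0.
Proof.
move=> cx cA; rewrite partE /part big1 // => i Ai.
have [-> | xi0] := eqVneq (coord b i x) 0; first by rewrite scale0r.
by case: (cA i Ai); apply: isotypic_coord xi0.
Qed.

Definition same c : pred 'I_n := fun i => `[< agree (chi i) c >].

Lemma same_isotypic c x : isotypic c (partL (same c) x).
Proof.
move=> g Pg; rewrite partE /part linear_sum scaler_sumr; apply: eq_bigr => i /asboolP ci.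
by rewrite linearZ /= chiP // ci // !scalerA mulrC.
Qed.

Lemma part_id c x : isotypic c x -> partL (same c) x = x.
Proof. by move=> cx; apply: part_isotypic cx _ => i ?; apply/asboolP. Qed.

Lemma part_rho A (B : pred 'I_n) h x :
  (forall i, A i -> forall j, agree (chi j) (conj_char h (chi i)) -> B j) ->
  (forall i, ~~ A i -> forall j, B j -> ~ agree (chi j) (conj_char h (chi i))) ->
  partL B (rho h x) = rho h (partL A x).
Proof.
move=> AB nAB; rewrite {1}(coord_sum x) linear_sum linear_sum /= (bigID A) /=.
rewrite [X in _ + X]big1 ?addr0 => [|i nAi]; last first.
  rewrite linearZ linearZ /= (part_isotypic0 (isotypic_conj _ (isotypic_basis i))) ?scaler0 //.
  by move=> j Bj; apply: nAB.
rewrite partE /part linear_sum; apply: eq_bigr => i Ai.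
rewrite linearZ linearZ /= linearZ /=; congr (_ *: _).
by apply: part_isotypic (isotypic_conj _ (isotypic_basis i)) _ => j; apply: AB.
Qed.

Lemma same_rho c h x : partL (same (conj_char h c)) (rho h x) = rho h (partL (same c) x).
Proof.
apply: part_rho => i; rewrite /same => /asboolP ci j.
  by move=> jh; apply/asboolP => g Pg; rewrite jh // (conj_agree _ ci).
move=> /asboolP jc jh; apply: ci.
have : agree (conj_char h (chi i)) (conj_char h c) by move=> g Pg; rewrite -jh // jc.
by move/(conj_agree h^-1%g); rewrite !conj_charM mulVg !conj_char1.
Qed.

Lemma basis_neq0 i : b`_i != 0.
Proof. by apply: free_not0 b_free _; apply: mem_nth; rewrite size_tuple. Qed.

(** The basis vectors whose character is conjugate to that of [i0] span a stable
    subspace, and so do the others. *)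
Lemma single_orbit i0 i : exists h, agree (chi i) (conj_char h (chi i0)).
Proof.
pose A : pred 'I_n := fun j => `[< exists h, agree (chi j) (conj_char h (chi i0)) >].
have AP j : reflect (exists h, agree (chi j) (conj_char h (chi i0))) (A j) by apply: asboolP.
have A_rho h x : partL A (rho h x) = rho h (partL A x).
  apply: part_rho => j Aj j'.
    move=> j'j; have /AP[h' jh'] := Aj; apply/AP; exists (h * h')%g => g Pg.
    by rewrite j'j // (conj_agree h jh') // conj_charM.
  move=> /AP[h' j'h'] j'j; case/AP: Aj; exists (h^-1 * h')%g => g Pg.
  have : agree (conj_char h (chi j)) (conj_char h' (chi i0)) by move=> g' Pg'; rewrite -j'j // j'h'.
  by move/(conj_agree h^-1%g)/(_ g Pg); rewrite !conj_charM mulVg conj_char1.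
have A_idem x : partL A (partL A x) = partL A x.
  rewrite [in RHS]partE /part [partL A x]partE /part linear_sum; apply: eq_bigr => j Aj.
  rewrite linearZ /=; congr (_ *: _); rewrite partE /part (bigD1 j) //=.
  rewrite coord_free // eqxx scale1r big1 ?addr0 // => j' /andP[_ j'j].
  by rewrite coord_free // eq_sym (negPf j'j) scale0r.
apply/AP; have [_ split_rho] := rho_indec.
have [||||U0|W0] := split_rho (limg (partL A)) (lker (partL A)).
- move=> g x /memv_imgP[y _ ->]; rewrite -A_rho; exact: memv_img (memvf _).
- by move=> g x; rewrite !memv_ker A_rho => /eqP->; rewrite linear0.
- apply/vspaceP => x; rewrite memvf; apply/memv_addP; exists (partL A x); first exact: memv_img (memvf _).
  by exists (x - partL A x); rewrite ?memv_ker ?linearB /= ?A_idem ?subrr // addrC subrK.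
- apply/vspaceP => x; rewrite memv_cap memv0; apply/andP/eqP => [[/memv_imgP[y _ ->]] | ->].
    by rewrite memv_ker A_idem => /eqP.
  by rewrite !mem0v.
- have i0A : A i0 by apply/AP; exists 1%g; rewrite conj_char1.
  have : partL A b`_i0 \in limg (partL A) by apply: memv_img (memvf _).
  rewrite U0 memv0 (part_isotypic (isotypic_basis i0)) ?(negPf (basis_neq0 _)) //.
  by move=> j ji; apply/AP; exists 1%g; rewrite conj_char1.
apply: contraT => nAi; have : b`_i \in lker (partL A).
  rewrite memv_ker (part_isotypic0 (isotypic_basis i)) // => j /AP[h jh] ji.
  by case/AP: nAi; exists h => g Pg; rewrite -ji // jh.
by rewrite W0 memv0 (negPf (basis_neq0 _)).
Qed.

(** The isomorphism sends [x] to the function [g |-> pr (rho g x)], with [pr] the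
    projection on the isotypic component [W]. Conversely, each isotypic component
    of [x] is carried to [W] by some element of [G], so it is recovered from the
    value of the function at this element. *)
Lemma induced_from_stabilizer i0 (W : {vspace V}) (H : set G)
    (sigma : G -> 'End(subvs_of W)) :
  (forall x, x \in W <-> isotypic (chi i0) x) ->
  (forall h, H h <-> agree (conj_char h (chi i0)) (chi i0)) ->
  (forall h (x : subvs_of W), H h -> vsval (sigma h x) = rho h (vsval x)) ->
  iso_induced H sigma rho.
Proof.
set c0 := chi i0 => WP HP sigmaP; pose pr := partL (same c0).
have prW x : pr x \in W by apply/WP; apply: same_isotypic.
have prH h x : H h -> pr (rho h x) = rho h (pr x).
  move=> /HP Hh; rewrite -same_rho /pr; congr (partL _ _).
  apply/funext => i; apply/asboolP/asboolP => ci g Pg.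
    by rewrite Hh // ci.
  by rewrite -Hh // ci.
exists (fun x g => vsproj W (pr (rho g x))); split.
- by move=> a x y g; rewrite !linearP.
- move=> x y xy.
  have {}xy g : pr (rho g x) = pr (rho g y).
    by rewrite -[LHS](vsprojK (prW _)) -[RHS](vsprojK (prW _)) (congr1 (fun f => f g) xy).
  rewrite (coord_sum x) (coord_sum y); apply: eq_bigr => i _; congr (_ *: _).
  have [h ih] := single_orbit i0 i.
  have hi : same (conj_char h c0) i by apply/asboolP.
  rewrite -(coord_part x hi) -(coord_part y hi).
  by rewrite -[x](rhoVK h) -[y](rhoVK h) !same_rho -!/pr xy.
- move=> f; split=> [[x <-] h g Hh | f_equiv].
    by apply: subvs_inj; rewrite sigmaP // !vsprojK // rhoE prH.
  have [gam gamP] := choice (single_orbit i0).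
  (* The coordinates of [x] on the isotypic component of [chi i] are read off at
     [gam i], which carries [W] to this component. *)
  pose F i := rho (gam i) (vsval (f (gam i)^-1%g)).
  exists (\sum_i coord b i (F i) *: b`_i); set x := \sum_i _; apply/funext => g.
  pose c := conj_char g^-1%g c0; pose y := rho g^-1%g (vsval (f g)).
  have cy : isotypic c y by apply: isotypic_conj; apply/WP; apply: subvsP.
  have xy : partL (same c) x = y.
    rewrite -(part_id cy) !partE /part; apply: eq_bigr => i ci; congr (_ *: _).
    transitivity (coord b i (F i)).
      rewrite /x linear_sum (bigD1 i) //= linearZ /= coord_free // eqxx mulr1.
      by rewrite big1 ?addr0 // => j ji; rewrite linearZ /= coord_free // (negPf ji) mulr0.
    have Hg : H (g * gam i)%g.
      apply/HP; rewrite -conj_charM => g' Pg'.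
      have /(conj_agree g)/(_ _ Pg') : agree (conj_char (gam i) c0) c.
        by move=> g'' Pg''; rewrite -gamP //; move/asboolP: ci => ->.
      by move=> ->; rewrite /c conj_charM mulgV conj_char1.
    congr (coord b i _); rewrite /y -[X in f X](mulgK (gam i) g) f_equiv // sigmaP //.
    by rewrite -rhoE mulgA mulVg mul1g.
  have cc : conj_char g c = c0 by rewrite /c conj_charM mulgV conj_char1.
  by rewrite /pr -cc same_rho xy /y rhoVK vsvalK.
by move=> g x g'; rewrite rhoE.
Qed.

End Clifford.

(** * Additive characters, continuity and Artin-Schreier characters *)

Section AdditiveCharacter.
Variables (p : nat) (E : fieldType) (psi : 'F_p -> E).
Hypotheses (p_prime : prime p) (psi_char : nontrivial_additive_char psi).
Implicit Types a b : 'F_p.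

Lemma addchar_mulrn a i : psi (a *+ i) = psi a ^+ i.
Proof.
elim: i => [|i IH]; first exact: (addchar0 psi_char).
by rewrite mulrS (addcharD psi_char) IH exprS.
Qed.

Lemma Fp_mulrn a : a *+ p = 0.
Proof. by rewrite mulrn_pchar // pchar_Fp. Qed.

Lemma addchar_pow a : psi a ^+ p = 1.
Proof. by rewrite -addchar_mulrn Fp_mulrn (addchar0 psi_char). Qed.

Lemma addchar_neq0 a : psi a != 0.
Proof.
apply: contraTneq (oner_neq0 E) => a0; rewrite -(addchar_pow a) a0.
by rewrite expr0n gtn_eqF ?eqxx // prime_gt0.
Qed.

Lemma addchar_ker b : psi b = 1 -> b = 0.
Proof.
move=> b1; apply/eqP; apply: contraT => b0; have [a []] := addchar_nontrivial psi_char.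
by rewrite -[a](divfK b0) -[a / b]natr_Zp mulr_natl addchar_mulrn b1 expr1n.
Qed.

Lemma addchar_inj : injective psi.
Proof.
move=> a b ab; apply/eqP; rewrite -subr_eq0; apply/eqP; apply: addchar_ker.
apply: (mulIf (addchar_neq0 b)).
by rewrite -(addcharD psi_char) subrK mul1r.
Qed.

Lemma addchar_primitive : p.-primitive_root (psi 1).
Proof.
have [m m_prim] := prim_order_exists (prime_gt0 p_prime) (addchar_pow 1).
have m1 : m != 1.
  apply/eqP => m1; move: m_prim; rewrite m1 => /prim_expr_order.
  by rewrite expr1 => /addchar_ker/eqP; rewrite oner_eq0.
by move/(prime_nt_dvdP p_prime m1) => mp; rewrite mp in m_prim.
Qed.

Lemma addchar_onto (z : E) : z ^+ p = 1 -> exists a, psi a = z.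
Proof.
by case/(prim_rootP addchar_primitive) => i ->; exists (1 *+ i); rewrite addchar_mulrn.
Qed.

End AdditiveCharacter.

Section Valuation.
Variables (E : fieldType) (v : E -> rat).
Hypothesis v_val : field_valuation v.

Lemma val_gtD N x y : val_gt v N x -> val_gt v N y -> val_gt v N (x + y).
Proof.
case=> [-> | vx]; first by rewrite add0r.
case=> [-> | vy]; first by rewrite addr0; right.
have [-> | x0] := eqVneq x 0; first by rewrite add0r; right.
have [-> | y0] := eqVneq y 0; first by rewrite addr0; right.
have [-> | xy0] := eqVneq (x + y) 0; first by left.
right; apply: lt_le_trans (v_val.2 x y x0 y0 xy0).
by rewrite lt_min vx vy.
Qed.

Lemma val_gt_sum I (r : seq I) (F : I -> E) N :
  (forall i, val_gt v N (F i)) -> val_gt v N (\sum_(i <- r) F i).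
Proof. by move=> FN; elim/big_rec: _ => [|i x _]; [left | apply: val_gtD]. Qed.

Lemma val_gtM N x a : val_gt v (N - v a) x -> val_gt v N (x * a).
Proof.
case=> [-> | vx]; first by left; rewrite mul0r.
have [-> | a0] := eqVneq a 0; first by left; rewrite mulr0.
have [-> | x0] := eqVneq x 0; first by left; rewrite mul0r.
by right; rewrite v_val.1 // -ltrBlDr.
Qed.

Variables (K L : fieldType) (iota : K -> L) (V : vectType E).
Variable rho : absgal iota -> 'End(V).
Hypothesis rho_rep : continuous_rep v setT rho.

(** Continuity of the coordinates in one basis gives that of any linear functional,
    so the target space of the representation may be changed linearly. *)
Lemma continuous_functional (f : V -> E) : linear_for *%R f ->
  forall x (g : absgal iota) N, exists s : seq L, forall h : absgal iota, (forall y, y \in s -> h y = g y) ->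
    val_gt v N (f (rho h x) - f (rho g x)).
Proof.
move=> f_lin x g N.
pose e := vbasis {:V}.
have fE z : f z = \sum_i coord e i z * f e`_i.
  pose fL : {scalar V} := HB.pack_for {scalar V} f (GRing.isLinear.Build E V E *%R f f_lin).
  rewrite {1}(coord_vbasis (memvf z)) -[LHS]/(fL _) linear_sum.
  by apply: eq_bigr => i _; rewrite linearZ.
have [s sP] : {s : 'I_(\dim {:V}) -> seq L & forall (i : 'I_(\dim {:V})) (h : absgal iota), (forall y, y \in s i -> h y = g y) ->
    val_gt v (N - v (f e`_i)) (coord e i (rho h x) - coord e i (rho g x))}.
  apply: (choice (P := fun (i : 'I_(\dim {:V})) (s : seq L) => forall h : absgal iota, (forall y, y \in s -> h y = g y) ->
    val_gt v (N - v (f e`_i)) (coord e i (rho h x) - coord e i (rho g x)))) => i.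
  have [s sP] := rep_continuous rho_rep x i (N - v (f e`_i)) (I : setT g).
  by exists s => h; apply: sP.
exists (flatten (codom s)) => h h_s.
rewrite (fE (rho h x)) (fE (rho g x)) -sumrB; apply: val_gt_sum => i.
rewrite -mulrBl; apply: val_gtM; apply: sP => y ys; apply: h_s.
by apply/flattenP; exists (s i) => //; apply: codom_f.
Qed.

End Valuation.

Section ArtinSchreierCharacter.
Variables (p : nat) (K L : fieldType) (iota : {rmorphism K -> L}).
Hypotheses (p_prime : prime p) (p_char : p \in [pchar L]).
Variables (E : fieldType) (psi : 'F_p -> E).

Lemma as_equation_diff (y z : L) : y ^+ p - y = z ^+ p - z ->
  exists a : 'F_p, y - z = (a : nat)%:R.
Proof.
move=> yz; apply: frobenius_fixed => //.
rewrite -(pFrobenius_autE p_char) rmorphB /= !pFrobenius_autE.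
have -> : y ^+ p = z ^+ p - z + y by rewrite -yz subrK.
ring.
Qed.

(** Two solutions of the Artin-Schreier equation differ by an element of the prime
    field, which [g] fixes, so any of them may be used. *)
Lemma artin_schreier_charE (g : absgal iota) (y c : L) (a : 'F_p) :
  y ^+ p - y = c -> g y - y = (a : nat)%:R -> artin_schreier_char psi c g = psi a.
Proof.
move=> yc ya; rewrite /artin_schreier_char; case: pickP => [a' /asboolP[y' [y'c y'a]] | /(_ a)].
  congr psi; apply: (natr_Fp_inj p_prime p_char); rewrite -ya -y'a.
  have [b yb] : exists b : 'F_p, y' - y = (b : nat)%:R.
    by apply: as_equation_diff; rewrite y'c yc.
  have -> : y' = y + (b : nat)%:R by rewrite -yb addrC subrK.
  by rewrite rmorphD rmorph_nat /=; ring.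
by move/asboolP => []; exists y.
Qed.

End ArtinSchreierCharacter.

(** * The structure theorem *)

Theorem proposition1p1
  (p l : nat) (p_prime : prime p) (l_prime : prime l) (l_neq_p : l <> p)
  (* k is an algebraic closure of a finite field of characteristic p *)
  (F0 : finFieldType) (F0_char : p \in [pchar F0])
  (k : closedFieldType) (F0_k : {rmorphism F0 -> k})
  (k_algebraic : forall x : k, algebraicOver F0_k x)
  (* an algebraic closure of Q_l, with the valuation defining its topology *)
  (Ql : fieldType) (vl : Ql -> rat) (Ql_padic : is_padic_field l vl)
  (Qlbar : closedFieldType) (Ql_Qlbar : {rmorphism Ql -> Qlbar})
  (v : Qlbar -> rat) (Qlbar_closure : is_padic_closure vl Ql_Qlbar v)
  (psi : 'F_p -> Qlbar) (psi_char : nontrivial_additive_char psi)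
  (* a separable closure of k((t)) *)
  (Ksep : fieldType) (iota : {rmorphism laurent k -> Ksep})
  (Ksep_closure : separable_closure iota)
  (V : vectType Qlbar) (rho : absgal iota -> 'End(V))
  (rho_rep : continuous_rep v setT rho)
  (rho_indec : indecomposable rho)
  (rho_trivial : forall g,
     wild_pth_powers_commutators p g -> rho g = \1%VF)
  (s : rat) (s_swan : swan p rho s) (s_lt_p : s < p%:R) :
  exists (r : nat) (u : Ksep) (phi : {poly k})
         (W : vectType Qlbar) (kappa : absgal iota -> 'End(W)),
    [/\ (0 < r)%N /\ coprime r p,
        u ^+ r = iota (laurentX k),
        phi`_0 = 0,
        continuous_rep v (galois_over_root u) kappa /\
          (forall g, wild_inertia p g -> kappa g = \1%VF)
      & iso_induced (galois_over_root u)
          (fun g => artin_schreier_char psi (eval_at_inv iota phi u) g *: kappa g)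
          rho].
Proof.
have p_char : p \in [pchar k] by apply: (rmorph_pchar F0_k).
have p_neq0 : p%:R != 0 :> Qlbar.
  rewrite -(rmorph_nat Ql_Qlbar) fmorph_eq0; apply/negP => p0.
  by have := padic_char0 Ql_padic p; rewrite !inE p_prime p0.
have v_val := padic_closure_valuation Qlbar_closure.
have KC := Ksep_char p_char iota.
pose P := @wild_inertia k Ksep iota p.
have rho_one := rep1 rho_rep.
have rhoM g h : rho (g * h)%g = (rho g \o rho h)%VF by apply: (repM rho_rep).
have rhoME g h x : rho (g * h)%g x = rho g (rho h x) by rewrite rhoM lfunE.
have rho_pow g x : P g -> iter p (rho g) x = x.
  move=> Pg; have -> : iter p (rho g) x = rho (g ^+ p)%g x.
    elim: (p) => [|m IH]; first by rewrite rho_one lfunE.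
    by rewrite iterS IH expgS rhoME.
  rewrite rho_trivial ?lfunE // => S _ _; apply; left; by exists g.
have rho_comm g h : P g -> P h -> forall x, rho g (rho h x) = rho h (rho g x).
  move=> Pg Ph x; rewrite -!rhoME commgC [LHS]rhoME.
  rewrite (rho_trivial [~ g, h]%g) ?lfunE // => S _ _; apply; right.
  by exists g, h.
have [n [b [chi [b_free b_span chiP]]]] := eigenbasis p_prime p_neq0
  (addchar_primitive p_prime psi_char) rho_comm rho_pow.
have P_normal g h : P g -> P (h^-1 * g * h)%g by apply: wild_normal.
have [i0 _] : exists i : 'I_n, True.
  case: n b chi b_free b_span chiP => [b chi' _ b_span _|n *]; last by exists ord0.
  case: rho_indec => V0 _; case: V0; apply/vspaceP => x; rewrite memvf.
  by have := b_span x; rewrite (tuple0 b) span_nil => ->.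
pose c := chi i0; pose v0 := b`_i0.
have v0_neq0 : v0 != 0 by apply: free_not0 b_free _; apply: mem_nth; rewrite size_tuple.
have cP g : P g -> rho g v0 = c g *: v0 by move=> Pg; apply: chiP.
(* The values of the character are p-th roots of unity, hence values of psi. *)
have [a aP] : {a : absgal iota -> 'F_p & forall g, P g -> psi (a g) = c g}.
  apply: (choice (P := fun g a => P g -> psi a = c g)) => g.
  have [Pg | nPg] := pselect (P g); last by exists 0.
  have [|a aE] := addchar_onto p_prime psi_char (z := c g); last by exists a.
  have : iter p (rho g) v0 = c g ^+ p *: v0.
    elim: (p) => [|m IH]; first by rewrite expr0 scale1r.
    by rewrite iterS IH linearZ /= cP // scalerA -exprSr.
  rewrite rho_pow // => /esym/eqP; rewrite -subr_eq0 -{2}[v0]scale1r -scalerBl.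
  by rewrite scaler_eq0 (negPf v0_neq0) orbF subr_eq0 => /eqP.
have a_inj := addchar_inj p_prime psi_char.
have aM g h : P g -> P h -> a (g * h)%g = a g + a h.
  move=> Pg Ph; apply: a_inj; rewrite (addcharD psi_char) !aP //; last exact: wild_groupM.
  have := rhoME g h v0; rewrite !cP //; last exact: wild_groupM.
  rewrite linearZ /= cP // scalerA [c h * _]mulrC => /eqP.
  rewrite -subr_eq0 -scalerBl scaler_eq0 (negPf v0_neq0) orbF subr_eq0.
  by move/eqP.
(* The homomorphism [a] is trivial near 1: a nonzero coordinate of [v0] is moved by
   a nontrivial root of unity by one of finitely many amounts, and a small enough
   neighbourhood excludes them all. *)
have [s0 a_s0] : exists s0 : seq Ksep, forall g, P g ->
    (forall y, y \in s0 -> g y = y) -> a g = 0.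
  have [i vi] : exists i, coord b i v0 != 0.
    by exists i0; rewrite coord_free // eqxx oner_eq0.
  pose N := \big[Num.max/0]_(d : 'F_p) v ((psi d - 1) * coord b i v0).
  have f_lin : linear_for *%R (coord b i) by move=> d x y; rewrite linearP.
  have [s0 s0P] := continuous_functional v_val rho_rep f_lin v0 1%g N.
  exists s0 => g Pg g_s0; apply/eqP; apply: contraT => ag0.
  have := s0P g g_s0; rewrite rho_one lfunE cP // linearZ /= -aP //.
  rewrite -[X in _ - X]mul1r -mulrBl => -[/eqP|].
    rewrite mulf_eq0 (negPf vi) orbF subr_eq0 => /eqP.
    by move/(addchar_ker psi_char)/eqP; rewrite (negPf ag0).
  rewrite ltNge /N => /negP[]; exact: le_bigmax.
have [r [u [phi [y [[r_gt0 r_p] ut phi0 yE [ya u_stab]]]]]] :=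
  character_field p_prime p_char Ksep_closure aM a_s0.
set e := eval_at_inv iota phi u in yE *.
pose H := galois_over_root u : set (absgal iota).
pose ct (g : absgal iota) := artin_schreier_char psi e g.
have ctE (g : absgal iota) (d : 'F_p) : g y - y = (d : nat)%:R -> ct g = psi d.
  by move=> gy; apply: artin_schreier_charE yE gy.
have Hb (g : absgal iota) : H g -> exists d : 'F_p, g y = y + (d : nat)%:R.
  move=> Hg; have [|d gy] := @as_equation_diff p Ksep p_prime KC (g y) y.
    by rewrite -rmorphXn -rmorphB /= yE; apply: eval_at_inv_fixed.
  by exists d; rewrite -gy addrC subrK.
(* Fixing [u] amounts to fixing [y] up to the prime field, and so to preserving the
   character. *)
have HP h : H h <-> agree P (conj_char h c) c.
  split=> [Hh g Pg | hc].
    rewrite /conj_char -!aP //; last exact: P_normal.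
    congr psi; apply: (natr_Fp_inj p_prime KC); rewrite -!ya //; last exact: P_normal.
    have [d hy] := Hb h Hh.
    have gy : g y = y + (a g : nat)%:R by rewrite -ya // addrC subrK.
    rewrite -!mulgA !absgalM hy rmorphD rmorph_nat /= gy addrAC -hy rmorphD rmorph_nat /=.
    by rewrite absgalK.
  apply: u_stab => g Pg; apply: a_inj; rewrite !aP //; first exact: hc.
  exact: P_normal.
pose W := limg (partL b (same P chi c)).
have WP x : x \in W <-> isotypic rho P c x.
  split=> [/memv_imgP[z _ ->] | cx]; first exact: same_isotypic.
  by rewrite -(part_id b_free b_span chiP cx); apply: memv_img (memvf _).
have HW h x : H h -> x \in W -> rho h x \in W.
  move=> /HP Hh /WP cx; apply/WP; apply: isotypic_agree Hh _.
  exact: isotypic_conj.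
(* The quotient of the isotypic component by the extension [ct] of its character. *)
pose Kf (g : absgal iota) (x : subvs_of W) := (ct g)^-1 *: vsproj W (rho g (vsval x)).
have Kf_lin g : linear (Kf g).
  by move=> d x z; rewrite /Kf !linearP.
pose kappa (g : absgal iota) : 'End(subvs_of W) :=
  linfun (HB.pack_for {linear subvs_of W -> subvs_of W} (Kf g)
    (GRing.isLinear.Build Qlbar _ _ *:%R (Kf g) (Kf_lin g))).
have kappaE g x : kappa g x = (ct g)^-1 *: vsproj W (rho g (vsval x)) by rewrite lfunE.
have kappaH g (x : subvs_of W) : H g -> vsval (kappa g x) = (ct g)^-1 *: rho g (vsval x).
  by move=> Hg; rewrite kappaE linearZ /= vsprojK // HW // subvsP.
have ct_neq0 g : H g -> ct g != 0.
  move=> /Hb[d gy]; rewrite (ctE g d) ?(addchar_neq0 p_prime psi_char) //.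
  by rewrite gy addrC addKr.
have kappa_wild g : P g -> kappa g = \1%VF.
  move=> Pg; apply/lfunP => x; rewrite kappaE lfunE /= (ctE g (a g)) ?ya //.
  have /WP/(_ g Pg) -> := subvsP x; rewrite linearZ /= vsvalK aP // scalerA mulVf ?scale1r //.
  by rewrite -aP // (addchar_neq0 p_prime psi_char).
exists r, u, phi, (subvs_of W), kappa; split=> //.
- split=> //; split.
  + by apply: kappa_wild; apply: wild_group1.
  + move=> g h Hg Hh; apply/lfunP => x; apply: subvs_inj; rewrite comp_lfunE.
    have Hgh : H (g * h)%g by rewrite /H /galois_over_root absgalM Hh.
    rewrite !kappaH // linearZ /= rhoME scalerA -invfM; congr (_^-1 *: _).
    have [dg gy] := Hb g Hg; have [dh hy] := Hb h Hh.
    rewrite (ctE g dg) ?gy ?addrK; last by rewrite addrC addKr.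
    rewrite (ctE h dh) ?hy; last by rewrite addrC addKr.
    rewrite -(addcharD psi_char); apply: ctE.
    by rewrite absgalM hy rmorphD rmorph_nat /= gy (natr_FpD p_prime KC); ring.
  move=> x i g N Hg.
  pose f (z : V) := (ct g)^-1 * coord (vbasis {:subvs_of W}) i (vsproj W z).
  have f_lin : linear_for *%R f.
    by move=> d z z'; rewrite /f !linearP /= mulrDr mulrCA.
  have [s1 s1P] := continuous_functional v_val rho_rep f_lin (vsval x) g N.
  exists (y :: s1) => h Hh h_s.
  have -> : coord (vbasis {:subvs_of W}) i (kappa h x) = f (rho h (vsval x)).
    rewrite kappaE linearZ /= /f; congr (_^-1 * _).
    have [d gy] := Hb g Hg; have hy : h y = g y by apply: h_s; apply: mem_head.
    by rewrite (ctE g d) ?(ctE h d) ?hy ?gy //; rewrite addrC addKr.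
  have -> : coord (vbasis {:subvs_of W}) i (kappa g x) = f (rho g (vsval x)).
    by rewrite kappaE linearZ.
  by apply: s1P => z zs; apply: h_s; rewrite inE zs orbT.
apply: (induced_from_stabilizer rho_one rhoM P_normal rho_indec b_free b_span chiP WP HP).
move=> h x Hh; rewrite scale_lfunE linearZ /= kappaH // scalerA mulfV ?scale1r //.
exact: ct_neq0.
Qed.
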